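(* Every prime graph with at least $5$ vertices has at least $2$ non-essential vertices unless it is locally equivalent to a cycle graph.
   Context: All graphs are finite and simple. For a vertex $v$ of a graph $G$, the local complementation $G*v$ is the graph on $V(G)$ obtained from $G$ by replacing the edges among the neighbors of $v$ by their complement, i.e. $E(G*v)=E(G)\triangle\{xy: x,y \text{ distinct neighbors of } v\}$. Two graphs are locally equivalent if one can be obtained from the other by a sequence of local complementations. For an edge $vw$, the pivoting is $G\wedge vw := G*v*w*v$. Let $G/v$ denote $G\setminus v$ if $v$ has no neighbor, and otherwise $G\wedge vw\setminus v$ for an arbitrary neighbor $w$ of $v$ (this is well defined up to local equivalence, so its primality does not depend on the choice of $w$). A split of a graph is a partition $(A,B)$ of its vertex set with $\min\{|A|,|B|\}\ge 2$ such that for some $A'\subseteq A$, $B'\subseteq B$, vertices $x\in A$, $y\in B$ are adjacent iff $x\in A'$ and $y\in B'$. A graph is prime if it has no split. A vertex $v$ of $G$ is non-essential if at least two of $G\setminus v$, $G*v\setminus v$, $G/v$ are prime. *)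

(* Defs.v *)
From mathcomp Require Import all_boot.
Set Implicit Arguments.
Unset Strict Implicit.
Unset Printing Implicit Defensive.

(* A simple graph whose vertex set is the whole finite type [T]. *)
Record sgraph (T : finType) := SGraph {
  adj :> rel T;
  adj_sym : symmetric adj;
  adj_irr : irreflexive adj
}.

Definition loc_adj (T : finType) (G : sgraph T) (v : T) : rel T :=
  fun x y => G x y (+) [&& x != y, G v x & G v y].

Lemma loc_adj_sym (T : finType) (G : sgraph T) (v : T) :
  symmetric (loc_adj G v).
Proof. by move=> x y; rewrite /loc_adj adj_sym eq_sym [G v x && _]andbC. Qed.

Lemma loc_adj_irr (T : finType) (G : sgraph T) (v : T) :
  irreflexive (loc_adj G v).
Proof. by move=> x; rewrite /loc_adj adj_irr eqxx. Qed.

Definition local_compl (T : finType) (G : sgraph T) (v : T) : sgraph T :=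
  SGraph (loc_adj_sym G v) (loc_adj_irr G v).

(* Graphs are compared by their adjacency relations, so that proofs of symmetry
   and irreflexivity play no role. *)
Definition locally_equivalent (T : finType) (G H : sgraph T) : Prop :=
  exists s : seq T, foldl (@local_compl T) G s =2 H.

Definition pivot (T : finType) (G : sgraph T) (v w : T) : sgraph T :=
  local_compl (local_compl (local_compl G v) w) v.

Definition del_adj (T : finType) (G : sgraph T) (v : T) :
    rel {x : T | x != v} :=
  fun x y => G (val x) (val y).

Lemma del_adj_sym (T : finType) (G : sgraph T) (v : T) :
  symmetric (@del_adj T G v).
Proof. by move=> x y; apply: adj_sym. Qed.

Lemma del_adj_irr (T : finType) (G : sgraph T) (v : T) :
  irreflexive (@del_adj T G v).
Proof. by move=> x; apply: adj_irr. Qed.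

Definition del (T : finType) (G : sgraph T) (v : T) :
    sgraph {x : T | x != v} :=
  SGraph (@del_adj_sym T G v) (@del_adj_irr T G v).

(* G / v; the neighbour of [v] is an arbitrary one, chosen by [pick], and the
   result depends on this choice only up to local equivalence. *)
Definition contract (T : finType) (G : sgraph T) (v : T) :
    sgraph {x : T | x != v} :=
  if [pick w | G v w] is Some w then del (pivot G v w) v else del G v.

Definition is_split (T : finType) (G : sgraph T) (A B : {set T}) : bool :=
  [&& A :|: B == [set: T], [disjoint A & B], 2 <= minn #|A| #|B| &
    [exists A' : {set T}, exists B' : {set T},
      [&& A' \subset A, B' \subset B &
        [forall x in A, forall y in B, G x y == ((x \in A') && (y \in B'))]]]].

Definition prime_graph (T : finType) (G : sgraph T) : bool :=
  ~~ [exists A : {set T}, exists B : {set T}, is_split G A B].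

(* The sum counts how many of the three graphs are prime. *)
Definition non_essential (T : finType) (G : sgraph T) (v : T) : bool :=
  2 <= prime_graph (del G v) + prime_graph (del (local_compl G v) v)
       + prime_graph (contract G v).

Definition is_cycle_graph (T : finType) (G : sgraph T) : Prop :=
  exists n : nat, 3 <= n /\
    exists f : 'I_n -> T, bijective f /\
      forall i j : 'I_n, G (f i) (f j) = (j == ordS i) || (i == ordS j).

(* Main.v *)
(** A prime graph G is replaced by its isotropic system L: the set of vectors x
in (F_2^2)^V with (x v).2 = sum of (x u).1 over the neighbours u of v.  Local
complementation only permutes the three nonzero values at each vertex, L is
self-orthogonal, and lam X = |X| - dim {x in L supported in X} is the cut-rank of
X.  Deleting v from G, G*v or G/v amounts to keeping the vectors whose value at v
is 0 or a fixed one of the three nonzero values.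

Call a 3-set a triplet if it supports a nonzero vector of L.  Submodularity of lam
shows that an essential vertex lies in a triplet, and that if e, f are essential
vertices of a triplet {e, f, g} then some other triplet contains e and exactly one
of f, g (the analogue of Tutte's triangle lemma).  Hence a chain of vertices whose
consecutive triples are triplets extends beyond an essential end vertex, unless it
closes up into a ring.  A longest chain therefore has two non-essential ends, or
there is a ring; a ring must cover all of V, and after suitable local
complementations its vectors become the neighbourhood vectors of a cycle. *)

From HB Require Import structures.
Require Import Defs.
From mathcomp Require Import all_boot all_order all_algebra.
From mathcomp Require Import zify.
Import GRing.Theory.
Set Implicit Arguments.
Unset Strict Implicit.
Unset Printing Implicit Defensive.

Notation pauli := (('F_2)^o * ('F_2)^o)%type.
Notation pvec T := {ffun T -> pauli}.

(** * Linear algebra over F_2 *)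

Section Pauli.
Local Open Scope ring_scope.

Lemma F2_cases (x : 'F_2) : x = 0 \/ x = 1.
Proof. by case: x => [[|[|//]] ?]; [left | right]; apply/val_inj. Qed.

Lemma pauli_cases (P : pauli -> Prop) :
  P (0, 0) -> P (0, 1) -> P (1, 0) -> P (1, 1) -> forall a, P a.
Proof.
by move=> P00 P01 P10 P11 [a b]; case: (F2_cases a) => ->; case: (F2_cases b) => ->.
Qed.

Definition pauliX : pauli := (1, 0).
Definition pauliY : pauli := (1, 1).
Definition pauliZ : pauli := (0, 1).

(** The symplectic form of the plane over F_2. For nonzero [a], [om u a = 0] reads: [u] is [0] or
    [a]. *)
Definition om (a b : pauli) : 'F_2 := a.1 * b.2 - a.2 * b.1.

Lemma omDl a b c : om (a + b) c = om a c + om b c.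
Proof. by rewrite /om /= !mulrDl opprD addrACA. Qed.

Lemma omDr a b c : om c (a + b) = om c a + om c b.
Proof. by rewrite /om /= !mulrDr opprD addrACA. Qed.

Lemma om0l a : om 0 a = 0.
Proof. by rewrite /om /= !mul0r subr0. Qed.

Lemma om0r a : om a 0 = 0.
Proof. by rewrite /om /= !mulr0 subr0. Qed.

Lemma omaa a : om a a = 0.
Proof. by rewrite /om mulrC subrr. Qed.

Lemma om_eq0 a b : a != 0 -> b != 0 -> (om a b == 0) = (a == b).
Proof. by elim/pauli_cases: a => //; elim/pauli_cases: b. Qed.

Lemma om_nondeg a : (forall b, om a b = 0) -> a = 0.
Proof.
move=> H; move: (H (0, 1)) (H (1, 0)).
by elim/pauli_cases: a {H} => // /eqP + /eqP.
Qed.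

Lemma F2_scale (V : lmodType 'F_2) (c : 'F_2) (x : V) : c *: x = 0 \/ c *: x = x.
Proof. by case: (F2_cases c) => ->; [left; rewrite scale0r | right; rewrite scale1r]. Qed.

Lemma F2_linear (U V : lmodType 'F_2) (f : U -> V) :
  {morph f : x y / x + y} -> linear f.
Proof.
move=> fD; have f0 : f 0 = 0 by apply: (addrI (f 0)); rewrite -fD !addr0.
move=> c x y; rewrite fD; congr (_ + _).
by case: (F2_cases c) => ->; rewrite ?scale0r ?scale1r.
Qed.

Lemma lfun_of (U V : vectType 'F_2) (f : U -> V) :
  {morph f : x y / x + y} -> exists g : 'Hom(U, V), g =1 f.
Proof.
move=> /F2_linear lin.
pose fM := GRing.isLinear.Build _ _ _ _ f lin.
pose fL : {linear U -> V} := HB.pack f fM.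
by exists (linfun fL) => x; rewrite lfunE.
Qed.

End Pauli.

(** * Dimensions of subspaces given by boolean predicates *)

Section Dimension.
Local Open Scope ring_scope.
Variable T : finType.
Implicit Types (P Q : pred (pvec T)) (x y : pvec T) (X Y : {set T}).

Definition subgroupP P := P 0 /\ forall x y, P x -> P y -> P (x + y).

Definition vsub P : {vspace pvec T} := <<enum P>>%VS.
Definition dm P := \dim (vsub P).

Lemma mem_vsub P x : subgroupP P -> (x \in vsub P) = P x.
Proof.
case=> P0 PD; apply/idP/idP => [|Px]; last by apply: memv_span; rewrite mem_enum.
rewrite /vsub => /(@coord_span _ _ _ (in_tuple (enum P))) ->.
apply: (big_ind (fun z => P z)) => // i _.
have: P (in_tuple (enum P))`_i.
  by have /(mem_nth 0) : (i < size (in_tuple (enum P)))%N by []; rewrite mem_enum.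
by case: (F2_scale (coord (in_tuple (enum P)) i x) (in_tuple (enum P))`_i) => ->.
Qed.

Lemma dm_mono P Q : subgroupP P -> subgroupP Q -> (forall x, P x -> Q x) ->
  (dm P <= dm Q)%N.
Proof.
by move=> sP sQ PQ; apply/dimvS/subvP => x; rewrite !mem_vsub //; apply: PQ.
Qed.

Lemma dm_strict P Q x : subgroupP P -> subgroupP Q -> (forall x, P x -> Q x) ->
  Q x -> ~~ P x -> (dm P < dm Q)%N.
Proof.
move=> sP sQ PQ Qx nPx.
have sub : (vsub P <= vsub Q)%VS by apply/subvP => y; rewrite !mem_vsub //; apply: PQ.
rewrite /dm ltn_neqAle dimvS // andbT (dimv_leqif_eq sub).
by apply: contra nPx => /eqP E; rewrite -(mem_vsub _ sP) E mem_vsub.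
Qed.

Lemma dm_submod P Q U I : subgroupP P -> subgroupP Q -> subgroupP U -> subgroupP I ->
  (forall x, P x -> U x) -> (forall x, Q x -> U x) ->
  (forall x, P x -> Q x -> I x) -> (dm P + dm Q <= dm U + dm I)%N.
Proof.
move=> sP sQ sU sI PU QU PQI; rewrite /dm -dimv_sum_cap leq_add //; apply: dimvS.
  by rewrite subv_add; apply/andP; split; apply/subvP => x; rewrite !mem_vsub //; auto.
by apply/subvP => x; rewrite memv_cap !mem_vsub // => /andP[]; apply: PQI.
Qed.

(** Rank and nullity: imposing [f u = 0] costs at most [dim V] dimensions. *)
Lemma dim_ker (U V : vectType 'F_2) (f : U -> V) (A B : {vspace U}) :
  {morph f : u v / u + v} -> (forall u, u \in A -> f u = 0 -> u \in B) ->
  (\dim A <= \dim B + dim V)%N.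
Proof.
move=> /lfun_of[g gE] H; rewrite -(limg_ker_dim g A) leq_add //.
  apply/dimvS/subvP => u; rewrite memv_cap memv_ker gE => /andP[uA /eqP].
  exact: H.
by rewrite -dimvf dimvS // subvf.
Qed.

Lemma dm_ker (V : vectType 'F_2) (f : pvec T -> V) P Q :
  subgroupP P -> subgroupP Q ->
  {morph f : x y / x + y} -> (forall x, P x -> f x = 0 -> Q x) ->
  (dm P <= dm Q + dim V)%N.
Proof.
by move=> sP sQ fD H; apply: (dim_ker fD) => x; rewrite !mem_vsub //; apply: H.
Qed.

Definition form x y : 'F_2 := \sum_v om (x v) (y v).

Lemma formDl x y z : form (x + y) z = form x z + form y z.
Proof. by rewrite -big_split; apply: eq_bigr => v _; rewrite ffunE omDl. Qed.

Lemma formDr x y z : form z (x + y) = form z x + form z y.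
Proof. by rewrite -big_split; apply: eq_bigr => v _; rewrite ffunE omDr. Qed.

Lemma form0r x : form x 0 = 0.
Proof. by apply: big1 => v _; rewrite ffunE om0r. Qed.

Definition supported (X : {set T}) : pred (pvec T) :=
  fun x => [forall v, (v \notin X) ==> (x v == 0)].

Lemma supportedP X x :
  reflect (forall v, v \notin X -> x v = 0) (supported X x).
Proof.
apply: (iffP forallP) => [H v vX | H v]; first by have := H v; rewrite vX => /eqP.
by apply/implyP => /H ->.
Qed.

Lemma supported_subgroup X : subgroupP (supported X).
Proof.
split=> [|x y /supportedP xX /supportedP yX].
  by apply/supportedP => v _; rewrite ffunE.
by apply/supportedP => v vX; rewrite ffunE xX // yX // addr0.
Qed.

Lemma supportedS (X Y : {set T}) x : X \subset Y -> supported X x -> supported Y x.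
Proof.
move=> /subsetP XY /supportedP xX; apply/supportedP => v vY; apply: xX.
by apply: contra vY; apply: XY.
Qed.

Lemma pred1_subgroup : subgroupP (pred1 (0 : pvec T)).
Proof. by split=> [|x y /eqP -> /eqP ->]; rewrite /= ?addr0. Qed.

Lemma dm_pred1 : dm (pred1 (0 : pvec T)) = 0%N.
Proof.
apply/eqP; rewrite dimv_eq0 -subv0; apply/subvP => x.
by rewrite (mem_vsub _ pred1_subgroup) memv0.
Qed.

Lemma dm_supported X : (dm (supported X) <= #|X| * 2)%N.
Proof.
have := @dm_ker {ffun 'I_#|X| -> pauli} (fun x => [ffun i => x (enum_val i)])
  (supported X) (pred1 0) (supported_subgroup X) pred1_subgroup.
rewrite dm_pred1 /dim /= card_ord; apply=> //.
  by move=> x y; apply/ffunP => i; rewrite !ffunE.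
move=> x /supportedP xX /ffunP H; apply/eqP/ffunP => v; rewrite ffunE.
case: (boolP (v \in X)) => [vX|/xX //].
by have := H (enum_rank_in vX v); rewrite !ffunE enum_rankK_in.
Qed.

End Dimension.

(** * Isotropic systems and the connectivity function *)

Section Isotropic.
Local Open Scope ring_scope.
Variable T : finType.
Implicit Types (x y t u : pvec T) (X Y A B : {set T}).

(* The dimension bound makes [L] a maximal isotropic subspace. *)
Record isotropic (L : pred (pvec T)) : Prop := Isotropic {
  iso_subgroup : subgroupP L;
  iso_form : forall x y, L x -> L y -> form x y = 0;
  iso_dim : (#|T| <= dm L)%N
}.

Definition sec (L : pred (pvec T)) X : pred (pvec T) :=
  fun x => L x && supported X x.

Definition dsec L X := dm (sec L X).

(* For [L = graph_sys G] this is the cut-rank of [X] in [G]. *)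
Definition lam L X : int := #|X|%:Z - (dsec L X)%:Z.

(** The inequality is [2 <= lam L X] without subtraction: no cut with two vertices on each side has
    cut-rank 0 or 1. *)
Definition prime_sys L :=
  forall X, (2 <= #|X|)%N -> (2 <= #|~: X|)%N -> (dsec L X + 2 <= #|X|)%N.

Variable L : pred (pvec T).
Hypothesis isoL : isotropic L.

Lemma sec_subgroup X : subgroupP (sec L X).
Proof.
case: (iso_subgroup isoL) (supported_subgroup X) => L0 LD [s0 sD].
split=> [|x y /andP[Lx sx] /andP[Ly sy]]; apply/andP; split; auto.
Qed.

Lemma secS X Y x : X \subset Y -> sec L X x -> sec L Y x.
Proof. by move=> XY /andP[Lx sx]; apply/andP; split=> //; apply: supportedS sx. Qed.

Lemma secP X x : reflect (L x /\ forall v, v \notin X -> x v = 0) (sec L X x).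
Proof.
by apply: (iffP andP) => -[Lx /supportedP ?].
Qed.

(* [L] pairs with the space of all vectors supported in [X]: the left kernel is
   [sec L (~: X)] and the right kernel contains [sec L X]. *)
Lemma dsec_setC_le X : (dsec L X + #|~: X| <= dsec L (~: X) + #|X|)%N.
Proof.
have sX := supported_subgroup X; have secX := sec_subgroup X.
have subR : (vsub (sec L X) <= vsub (supported X))%VS.
  by apply/subvP => x; rewrite !mem_vsub // => /andP[].
(* [L] is already orthogonal to [sec L X], so only a complement [Q] of it imposes conditions. *)
pose Q := (vsub (supported X) :\: vsub (sec L X))%VS.
have dimQ : (\dim Q + dsec L X <= #|X| * 2)%N.
  apply: leq_trans (dm_supported X); rewrite /dm addnC.
  by rewrite -(dimv_cap_compl (vsub (supported X)) (vsub (sec L X))) (capv_idPr subR).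
pose f x : {ffun 'I_(\dim Q) -> ('F_2)^o} :=
  [ffun i : 'I_(\dim Q) => form x (vbasis Q)`_i].
have := @dm_ker _ _ f L (sec L (~: X)) (iso_subgroup isoL) (sec_subgroup _).
rewrite /dim /= card_ord muln1 => H; have {H} : (dm L <= dm (sec L (~: X)) + \dim Q)%N.
  apply: H; first by move=> x y; apply/ffunP => i; rewrite !ffunE formDl.
  move=> x Lx fx0.
  have kerQ y : y \in Q -> form x y = 0.
    move=> /(coord_vbasis) ->.
    apply: (big_ind (fun z => form x z = 0)) => [|y1 y2 h1 h2|i _].
    + exact: form0r.
    + by rewrite formDr h1 h2 addr0.
    + case: (F2_scale (coord (vbasis Q) i y) (vbasis Q)`_i) => ->.
        exact: form0r.
      by move/ffunP/(_ i): fx0; rewrite !ffunE.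
  have kerX y : supported X y -> form x y = 0.
    rewrite -(mem_vsub _ sX) -(addv_diff_cap (vsub (supported X)) (vsub (sec L X))).
    move=> /memv_addP[y1 /kerQ h1 [y2 + ->]].
    rewrite memv_cap (mem_vsub _ secX) => /andP[_ /andP[Ly2 _]].
    by rewrite formDr h1 (iso_form isoL Lx Ly2) addr0.
  apply/secP; split=> // v; rewrite inE negbK => vX; apply: om_nondeg => a.
  have := kerX [ffun u => if u == v then a else 0].
  rewrite /form (bigD1 v) //= ffunE eqxx big1 ?addr0; last first.
    by move=> u uv; rewrite ffunE (negPf uv) om0r.
  apply; apply/supportedP => u uX; rewrite ffunE; case: eqP => // E.
  by rewrite E vX in uX.
move=> H; have := iso_dim isoL; have := cardsC X; move: dimQ; rewrite /dsec; lia.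
Qed.

Lemma lamC X : lam L (~: X) = lam L X.
Proof.
have := dsec_setC_le X; have := dsec_setC_le (~: X); rewrite setCK /lam; lia.
Qed.

Lemma lam_submod X Y : lam L (X :|: Y) + lam L (X :&: Y) <= lam L X + lam L Y.
Proof.
have := @dm_submod _ (sec L X) (sec L Y) (sec L (X :|: Y)) (sec L (X :&: Y)).
move=> /(_ (sec_subgroup _) (sec_subgroup _) (sec_subgroup _) (sec_subgroup _)).
move=> /(_ (fun x => secS (subsetUl _ _)) (fun x => secS (subsetUr _ _))) H.
have := cardsUI X Y; rewrite /lam /dsec.
have: forall x, sec L X x -> sec L Y x -> sec L (X :&: Y) x.
  move=> x /secP[Lx xX] /secP[_ xY]; apply/secP; split=> // v.
  by rewrite inE negb_and => /orP[/xX|/xY].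
move=> /H; lia.
Qed.

End Isotropic.

(** * Triplets of a prime isotropic system *)

Section PrimeSystem.
Local Open Scope ring_scope.
Variables (T : finType) (L : pred (pvec T)).
Hypothesis isoL : isotropic L.
Hypothesis primeL : prime_sys L.
Implicit Types (x y t u s : pvec T) (X Y A B C : {set T}) (e f g v w : T).

Lemma lam_ge2 X : (2 <= #|X|)%N -> (2 <= #|~: X|)%N -> 2 <= lam L X.
Proof. by move=> X2 cX2; have := primeL X2 cX2; rewrite /lam; lia. Qed.

Lemma dsec_exit e X : (dsec L X < dsec L (e |: X))%N ->
  exists2 u, sec L (e |: X) u & u e != 0.
Proof.
move=> lt; case: (boolP [exists u, sec L (e |: X) u && (u e != 0)]).
  by case/existsP => u /andP[]; exists u.
rewrite negb_exists => /forallP H; move: lt; rewrite ltnNge => /negP[].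
apply: dm_mono; try exact: sec_subgroup.
move=> u su; have := H u; rewrite su /= negbK => /eqP ue.
move/secP: su => [Lu su]; apply/secP; split=> // v vX.
by case: (eqVneq v e) => [->//|ve]; apply: su; rewrite !inE negb_or ve.
Qed.

Lemma dsec_grow e X t : e \notin X -> sec L (e |: X) t -> t e != 0 ->
  (dsec L X < dsec L (e |: X))%N.
Proof.
move=> eX st te; apply: (@dm_strict _ _ _ t) => //; try exact: sec_subgroup.
  by move=> u; apply: secS; apply: subsetUr.
by apply: contra te => /secP[_ /(_ _ eX) ->].
Qed.

Lemma sec_om_subgroup X e a : subgroupP (fun u => sec L X u && (om (u e) a == 0)).
Proof.
have [s0 sD] := sec_subgroup isoL X; split=> [|x y /andP[sx /eqP ox] /andP[sy /eqP oy]].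
  by rewrite s0 ffunE om0l eqxx.
by rewrite sD // ffunE omDl ox oy addr0 eqxx.
Qed.

(** The sections of [e |: X] whose value at [e] pairs to zero with [t e] lie strictly between: they
    contain [t], which is not supported in [X], and miss [s]. *)
Lemma dsec_grow2 e X s t : e \notin X -> sec L (e |: X) s -> sec L (e |: X) t ->
  om (s e) (t e) != 0 -> (dsec L X + 2 <= dsec L (e |: X))%N.
Proof.
move=> eX ss st ost.
have te : t e != 0 by apply: contraNneq ost => ->; rewrite om0r.
apply: (@leq_trans (dm (fun u => sec L (e |: X) u && (om (u e) (t e) == 0))).+1).
  rewrite addn2 ltnS; apply: (@dm_strict _ _ _ t); try exact: sec_subgroup.
  - exact: sec_om_subgroup.
  - move=> u su; rewrite (secS (subsetUr _ _) su) /=.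
    by case/secP: su => _ /(_ _ eX) ->; rewrite om0l.
  - by rewrite st omaa eqxx.
  - by apply: contra te => /secP[_ /(_ _ eX) ->].
apply: (@dm_strict _ _ _ s) => //; try exact: sec_subgroup.
- exact: sec_om_subgroup.
- by move=> u /andP[].
- by rewrite ss (negPf ost).
Qed.

Lemma cards3 e f g : uniq [:: e; f; g] -> #|[set e; f; g]| = 3%N.
Proof.
move=> U; rewrite -[RHS]/(size [:: e; f; g]) -(card_uniqP U).
by apply: eq_card => v; rewrite !inE orbA.
Qed.

Hypothesis T5 : (5 <= #|T|)%N.

(** Primality applied to a pair leaves dimension 0; for [e = f] the singleton is first enlarged to a
    pair. *)
Lemma sec_pair0 e f u : sec L [set e; f] u -> u = 0.
Proof.
move=> su; have Le: (#|[set e; f]| <= 2)%N by rewrite cards2; case: (e != f).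
have : dsec L [set e; f] = 0%N.
  case: (eqVneq e f) => [E|ef]; last first.
    have E2: #|[set e; f]| = 2%N by rewrite cards2 ef.
    have := primeL (X := [set e; f]); have := cardsC [set e; f]; lia.
  have [g ge] : exists g, g != e.
    have : (0 < #|[set~ e]|)%N by have := cardsC1 e; lia.
    by rewrite card_gt0 => /set0Pn[g]; rewrite !inE; exists g.
  have E2: #|[set g; e]| = 2%N by rewrite cards2 ge.
  have := primeL (X := [set g; e]); have := cardsC [set g; e].
  have : (dsec L [set e; f] <= dsec L [set g; e])%N; last by lia.
  apply: dm_mono; try exact: sec_subgroup; move=> x; apply: secS.
  by rewrite -E setUid subsetUr.
move=> /eqP; rewrite dimv_eq0 => /eqP E0.
by apply/eqP; rewrite -memv0 -E0 mem_vsub //; apply: sec_subgroup.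
Qed.

Definition tri e f g := uniq [:: e; f; g] && (0 < dsec L [set e; f; g])%N.

Definition tvec t e f g :=
  [/\ L t, uniq [:: e; f; g] & forall v, (t v != 0) = (v \in [:: e; f; g])].

Lemma triP e f g : tri e f g <-> exists t, tvec t e f g.
Proof.
split=> [/andP[U]|[t [Lt U tE]]].
  rewrite lt0n dimv_eq0 => /negPf nz.
  have [t tL t0] : exists2 t, t \in vsub (sec L [set e; f; g]) & t != 0.
    exists (vpick (vsub (sec L [set e; f; g]))); first exact: memv_pick.
    by rewrite vpick0 nz.
  move: tL; rewrite mem_vsub; last exact: sec_subgroup.
  case/secP => Lt tS; exists t; split=> // v.
  case: (boolP (v \in [:: e; f; g])) => [vS|vS]; last first.
    by rewrite tS ?eqxx //; move: vS; rewrite !inE orbA.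
  apply: contra_neqN t0 => /eqP tv.
  suff [x [y sxy]] : exists x y : T, sec L [set x; y] t by apply: sec_pair0 sxy.
  move: vS; rewrite !inE => /or3P[] /eqP E; subst v;
    [exists f, g | exists e, g | exists e, f]; apply/secP; split=> // w wS.
  - by case: (eqVneq w e) => [->//|we]; apply: tS; move: wS; rewrite !inE (negPf we).
  - by case: (eqVneq w f) => [->//|we]; apply: tS; move: wS; rewrite !inE (negPf we) orbF.
  - by case: (eqVneq w g) => [->//|we]; apply: tS; move: wS; rewrite !inE (negPf we) orbF.
apply/andP; split=> //; rewrite lt0n dimv_eq0.
have : t \in vsub (sec L [set e; f; g]).
  rewrite mem_vsub; last exact: sec_subgroup.
  apply/secP; split=> // v vS; apply/eqP; rewrite -[_ == _]negbK tE.
  by move: vS; rewrite !inE orbA.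
apply: contraTneq => ->; rewrite memv0; apply/negP => /eqP t0.
by have := tE e; rewrite t0 ffunE !inE eqxx.
Qed.

Lemma tvec_sec t e f g : tvec t e f g -> sec L [set e; f; g] t.
Proof.
case=> Lt U tE; apply/secP; split=> // v vS; apply/eqP; rewrite -[_ == _]negbK tE.
by move: vS; rewrite !inE orbA.
Qed.

Lemma tvec_perm t e f g e' f' g' : perm_eq [:: e; f; g] [:: e'; f'; g'] ->
  tvec t e f g -> tvec t e' f' g'.
Proof.
move=> p [Lt U tE]; split; rewrite -?(perm_uniq p) // => v.
by rewrite -(perm_mem p).
Qed.

Lemma tri_perm e f g e' f' g' : perm_eq [:: e; f; g] [:: e'; f'; g'] ->
  tri e f g -> tri e' f' g'.
Proof.
move=> p /andP[U d]; rewrite /tri -(perm_uniq p) U.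
have <- // : [set e; f; g] = [set e'; f'; g'].
by apply/setP => v; have := perm_mem p v; rewrite !inE !orbA.
Qed.

Lemma perm12 e f g : perm_eq [:: e; f; g] [:: f; e; g].
Proof. exact: (permEl (perm_catCA [:: e] [:: f] [:: g])). Qed.

Lemma perm23 e f g : perm_eq [:: e; f; g] [:: e; g; f].
Proof. by rewrite perm_cons; apply: (permEl (perm_catC [:: f] [:: g])). Qed.

Lemma perm13 e f g : perm_eq [:: e; f; g] [:: g; f; e].
Proof.
by apply: perm_trans (perm12 _ _ _) (perm_trans (perm23 _ _ _) (perm12 _ _ _)).
Qed.

Lemma om_share1 s t v : L s -> L t -> (forall w, w != v -> s w = 0 \/ t w = 0) ->
  om (s v) (t v) = 0.
Proof.
move=> Ls Lt H; have := iso_form isoL Ls Lt.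
rewrite /form (bigD1 v) //= big1 ?addr0 // => w /H[] ->; first exact: om0l.
exact: om0r.
Qed.

(** If [s] and [t] agreed at [e], isotropy would make them agree at [f]; then [s + t] would be
    supported in [{g, h}], hence zero, although it is nonzero at [g]. *)
Lemma om_share2 s t e f g h : tvec s e f g -> tvec t e f h -> g != h ->
  om (s e) (t e) != 0.
Proof.
move=> ts tt gh; have [Ls Us sE] := ts; have [Lt Ut tE] := tt.
have [ef eg fg] : [/\ e != f, e != g & f != g].
  by move: Us; rewrite /= !inE negb_or andbT => /andP[/andP[]].
have [eh fh] : e != h /\ f != h.
  by move: Ut; rewrite /= !inE negb_or andbT => /andP[/andP[]].
apply/eqP => oe.
have of0 : om (s f) (t f) = 0.
  have := iso_form isoL Ls Lt.
  rewrite /form (bigD1 e) //= oe add0r (bigD1 f) 1?eq_sym //= big1 ?addr0 //.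
  move=> u /andP[ue uf]; case: (eqVneq (s u) 0) => [->|su]; first exact: om0l.
  move: su; rewrite sE !inE (negPf ue) (negPf uf) /= => /eqP E; subst u.
  case: (eqVneq (t g) 0) => [->|]; first exact: om0r.
  by rewrite tE !inE (negPf ue) (negPf uf) (negPf gh).
have ee : s e = t e by apply/eqP; rewrite -om_eq0 ?oe // ?sE ?tE !inE eqxx.
have ff : s f = t f by apply/eqP; rewrite -om_eq0 ?of0 // ?sE ?tE !inE eqxx orbT.
have [_ LD] := iso_subgroup isoL.
have F2 (a : pauli) : a + a = 0 by elim/pauli_cases: a; apply/eqP.
have : s + t = 0.
  apply: (@sec_pair0 g h); apply/secP; split; first exact: LD.
  move=> v; rewrite !inE negb_or => /andP[vg vh]; rewrite ffunE.
  case: (eqVneq v e) => [->|ve]; first by rewrite ee F2.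
  case: (eqVneq v f) => [->|vf]; first by rewrite ff F2.
  have /eqP -> : s v == 0 by rewrite -[_ == _]negbK sE !inE (negPf ve) (negPf vf) (negPf vg).
  have /eqP -> : t v == 0 by rewrite -[_ == _]negbK tE !inE (negPf ve) (negPf vf) (negPf vh).
  exact: addr0.
move/ffunP/(_ g); rewrite !ffunE.
have /eqP -> : t g == 0.
  by rewrite -[_ == _]negbK tE !inE ![g == _]eq_sym (negPf eg) (negPf fg) eq_sym (negPf gh).
by rewrite addr0 => /eqP; rewrite -[_ == _]negbK sE !inE eqxx !orbT.
Qed.

End PrimeSystem.

(** * Splits of minors and the triangle lemma *)

Section Splits.
Local Open Scope ring_scope.
Variables (T : finType) (L : pred (pvec T)).
Hypothesis isoL : isotropic L.
Hypothesis primeL : prime_sys L.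
Implicit Types (x y t u s : pvec T) (X Y A B C Z : {set T}) (e f g v w : T).

(* [(A, V - e - A)] is a split of the minor of [L] that keeps the vectors with value
   [0] or [a] at [e]; for a prime system this takes the following form, where
   [~: A] is [e] added to the other side. *)
Definition dsplit e (a : pauli) A :=
  [/\ e \notin A, (2 <= #|A|)%N /\ (2 <= #|~: (e |: A)|)%N,
      lam L (e |: A) <= 2 /\ lam L A <= 2,
      forall u, sec L (e |: A) u -> om (u e) a = 0
    & forall u, sec L (~: A) u -> om (u e) a = 0].

Lemma setU1_compl e A : e \notin A -> e |: ~: (e |: A) = ~: A.
Proof.
by move=> eA; apply/setP => v; rewrite !inE; case: (eqVneq v e) => [->|].
Qed.

Lemma dsplitC e a A : dsplit e a A -> dsplit e a (~: (e |: A)).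
Proof.
case=> eA [A2 B2] [l1 l2] o1 o2; rewrite /dsplit setU1_compl // !setCK !lamC //.
by rewrite !inE eqxx.
Qed.

Lemma lam_le2_tri e X : e \notin X -> #|X| = 2%N -> lam L (e |: X) <= 2 ->
  exists x y : T, X = [set x; y] /\ tri L e x y.
Proof.
move=> eX /eqP/cards2P[x [y [xy E]]] l2; exists x, y; split=> //; subst X.
move: eX; rewrite !inE negb_or => /andP[ex ey].
have E : e |: [set x; y] = [set e; x; y] by rewrite setUA.
have U : uniq [:: e; x; y] by rewrite /= !inE negb_or ex ey xy.
by rewrite /tri U /=; move: l2; rewrite E /lam cards3 //; lia.
Qed.

(** A common section of [e |: A] and [e |: C] pairs to zero with both [a] and [b] at [e], so it
    vanishes there and lives on [A :&: C]. This improves the submodular bound from 4 to 3, below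
    what primality asks of two large cuts. *)
Lemma dsplit_cross e a b A C : a != 0 -> b != 0 -> a != b -> dsplit e a A -> dsplit e b C ->
  (#|A :&: C| <= 1)%N \/ (#|~: (e |: (A :|: C))| <= 1)%N.
Proof.
move=> a0 b0 ab [eA [A2 A2'] [lA _] oA _] [eC [C2 C2'] [lC _] oC _].
have le3 : lam L (e |: (A :|: C)) + lam L (A :&: C) <= 3.
  have := @dm_submod _ (sec L (e |: A)) (sec L (e |: C))
    (sec L (e |: (A :|: C))) (sec L (A :&: C)).
  move=> H; have {H} : (dsec L (e |: A) + dsec L (e |: C) <=
     dsec L (e |: (A :|: C)) + dsec L (A :&: C))%N.
    apply: H; try exact: sec_subgroup.
    - by move=> x; apply: secS; rewrite setUS // subsetUl.
    - by move=> x; apply: secS; rewrite setUS // subsetUr.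
    move=> x sA sC; have xa := oA _ sA; have xb := oC _ sC.
    have x0 : x e = 0.
      apply/eqP; apply: contraNT ab => x0.
      move/eqP: xa; move/eqP: xb; rewrite !om_eq0 // => /eqP <- /eqP <-; exact: eqxx.
    case/secP: sA => Lx sA; case/secP: sC => _ sC.
    apply/secP; split=> // v; rewrite inE negb_and.
    case: (eqVneq v e) => [->//|ve] /orP[vA|vC].
      by apply: sA; rewrite !inE negb_or ve.
    by apply: sC; rewrite !inE negb_or ve.
  have := cardsUI A C; have eAC : e \notin A :|: C by rewrite inE negb_or eA.
  by move: lA lC; rewrite /lam !cardsU1 eA eC eAC; lia.
case: (leqP #|A :&: C| 1) => [|AC2]; first by left.
case: (leqP #|~: (e |: (A :|: C))| 1) => [|AC2']; first by right.
have := lam_ge2 primeL AC2; rewrite -(lamC isoL (e |: _)) in le3.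
have := lam_ge2 primeL AC2'; rewrite setCK.
have : (#|A| <= #|e |: (A :|: C)|)%N.
  by apply: subset_leq_card; apply: subset_trans (subsetUl _ _) (subsetUr _ _).
have : (#|~: (e |: A)| <= #|~: (A :&: C)|)%N.
  apply: subset_leq_card; rewrite setCS; apply: subset_trans (subsetIl _ _) (subsetUr _ _).
by lia.
Qed.

(** Crossing [A] with [C] and with its opposite side leaves at most one vertex in a quarter of each
    diagonal pair. Two such quarters form one of the four sides, which then has two vertices and
    gives a triplet. *)
Lemma dsplit2_tri e a b A C : a != 0 -> b != 0 -> a != b ->
  dsplit e a A -> dsplit e b C -> exists x y : T, tri L e x y.
Proof.
move=> a0 b0 ab sA sC.
have trip X c : dsplit e c X -> (#|X| <= 2)%N -> exists x y : T, tri L e x y.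
  case=> eX [X2 _] [l2 _] _ _ X2'.
  by have [|x [y [_ ?]]] := lam_le2_tri eX _ l2; [lia | exists x, y].
have c1 := dsplit_cross a0 b0 ab sA sC; have c2 := dsplit_cross a0 b0 ab sA (dsplitC sC).
have [eA _ _ _ _] := sA; have [eC _ _ _ _] := sC.
have E1 : A :&: ~: (e |: C) = A :\: C.
  apply/setP => v; rewrite !inE; case: (eqVneq v e) => [->|_]; last by rewrite andbC.
  by rewrite (negPf eA) andbF.
have E2 : ~: (e |: (A :|: ~: (e |: C))) = C :\: A.
  by apply/setP => v; rewrite !inE; case: (eqVneq v e) => [->|_];
    rewrite ?(negPf eC) ?andbF //= negb_or negbK.
have E3 : ~: (e |: (A :|: C)) = ~: (e |: A) :\: C.
  by apply/setP => v; rewrite !inE !negb_or; do ![case: (_ \in _) | case: (_ == _)].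
have E4 : ~: (e |: A) :&: C = C :\: A.
  apply/setP => v; rewrite !inE !negb_or; case: (eqVneq v e) => [->|_] //.
  by rewrite (negPf eC) !andbF.
have E5 : ~: (e |: (A :|: C)) = ~: (e |: C) :\: A.
  by apply/setP => v; rewrite !inE !negb_or; do ![case: (_ \in _) | case: (_ == _)].
have E6 : ~: (e |: C) :&: A = A :\: C by rewrite setIC.
rewrite {}E1 {}E2 in c2.
case: c1 => c1; case: c2 => c2.
- by apply: trip sA _; have := cardsID C A; lia.
- by apply: trip sC _; have := cardsID A C; rewrite setIC; lia.
- by apply: trip (dsplitC sC) _; have := cardsID A (~: (e |: C)); rewrite E6 -E5; lia.
- by apply: trip (dsplitC sA) _; have := cardsID C (~: (e |: A)); rewrite E4 -E3; lia.
Qed.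

Hypothesis T5 : (5 <= #|T|)%N.

(** A section of [e |: X] nonzero at [e] would have the value [a] there by the condition on [Z], yet
    it meets [t] only at [e], which forces the value [t e]. So [e] adds a vertex and no vector. *)
Lemma lam_lt_setU1 t e f g a X Z : tvec L t e f g -> a != 0 -> t e != a ->
  (forall u, sec L Z u -> om (u e) a = 0) -> e |: X \subset Z ->
  e \notin X -> f \notin X -> g \notin X ->
  lam L X < lam L (e |: X).
Proof.
move=> tt a0 ta oZ XZ eX fX gX.
suff : ~~ (dsec L X < dsec L (e |: X))%N by rewrite /lam cardsU1 eX -leqNgt; lia.
apply/negP => /(dsec_exit isoL)[u su u0].
have [Lt Ut tE] := tt.
have ua := oZ _ (secS XZ su); move/eqP: ua; rewrite om_eq0 // => /eqP ua.
have := om_share1 (v := e) isoL (proj1 (secP _ _ _ su)) Lt.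
case/secP: su => Lu su.
move=> H; have {H} : om (u e) (t e) = 0.
  apply: H => w we; case: (eqVneq (t w) 0) => tw; [by right | left].
  apply: su; rewrite !inE negb_or we /=; move: tw; rewrite tE !inE (negPf we) /=.
  by case/orP => /eqP ->.
move/eqP; rewrite om_eq0 ?tE ?inE ?eqxx // => /eqP E.
by move: ta; rewrite -E ua eqxx.
Qed.

(* [V - e - f] is divided into [P = A :&: C], [Q = ~: (A :|: C)], [S] and
   [A :\: C :\ f]; each case either makes one of the sets [A], [C], their complements
   or [P] small enough to give a triplet, or contradicts [lam_lt_setU1]. *)
Lemma triangle t e f g a b A C : tvec L t e f g -> a != 0 -> t e != a ->
  dsplit e a A -> b != 0 -> t f != b -> dsplit f b C ->
  exists w : T, (w != g /\ tri L e f w) \/ (w != f /\ tri L e g w).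
Proof.
move=> tt a0 ta sA b0 tb sC; have [Lt U tE] := tt.
have [ef eg fg] : [/\ e != f, e != g & f != g].
  by move: U; rewrite /= !inE negb_or andbT => /andP[/andP[]].
have [fe ge gf] : [/\ f != e, g != e & g != f] by split; rewrite eq_sym.
(* [A] separates [f] from [g]: otherwise [t] would be a section of one side together with [e], and
   [t e] would pair to zero with [a]. *)
wlog [fA gA] : A sA / f \in A /\ g \notin A.
  move=> W.
  have [eA _ _ oA oA'] := sA.
  have N : om (t e) a != 0 by rewrite om_eq0 // tE !inE eqxx.
  case fA : (f \in A); case gA: (g \in A).
  - case/eqP: N; apply: oA; apply: secS (tvec_sec tt).
    by apply/subsetP => v; rewrite !inE => /orP[/orP[]|] /eqP -> ; rewrite ?eqxx ?fA ?gA ?orbT.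
  - by apply: (W A); rewrite // fA gA.
  - by apply: (W _ (dsplitC sA)); rewrite !inE !negb_or fA gA fe ge.
  - case/eqP: N; apply: oA'; apply: secS (tvec_sec tt).
    by apply/subsetP => v; rewrite !inE => /orP[/orP[]|] /eqP -> ; rewrite ?fA ?gA ?eA.
wlog [eC gC] : C sC / e \in C /\ g \notin C.
  move=> W.
  have [fC _ _ oC oC'] := sC.
  have N : om (t f) b != 0 by rewrite om_eq0 // tE !inE eqxx orbT.
  case eC : (e \in C); case gC: (g \in C).
  - case/eqP: N; apply: oC; apply: secS (tvec_sec tt).
    by apply/subsetP => v; rewrite !inE => /orP[/orP[]|] /eqP -> ; rewrite ?eqxx ?eC ?gC ?orbT.
  - by apply: (W C); rewrite // eC gC.
  - by apply: (W _ (dsplitC sC)); rewrite !inE !negb_or eC gC ef gf.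
  - case/eqP: N; apply: oC'; apply: secS (tvec_sec tt).
    by apply/subsetP => v; rewrite !inE => /orP[/orP[]|] /eqP -> ; rewrite ?eC ?gC ?fC.
have [eA [A2 A2'] [lA lA'] oA oA'] := sA; have [fC [C2 C2'] [lC lC'] oC oC'] := sC.
set S := C :\: (e |: A).
have eS : e \notin S by rewrite !inE eqxx.
have fS : f \notin S by rewrite !inE fA orbT.
have gS : g \notin S by rewrite !inE (negPf gC) andbF.
have ES : e |: S = C :\: A.
  apply/setP => v; rewrite !inE negb_or; case: (eqVneq v e) => [->|_] //=.
  by rewrite eA eC.
have ESC : ~: S = (e |: A) :|: ~: C by apply/setP => v; rewrite !inE negb_and negbK.
(* The first inequality forces [lam] to be exactly 2 on [S] and [A :\: C]; the second bounds
   [lam L (e |: S)] by 2, against its strict increase over [lam L S]. *)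
have claim1 : (2 <= #|S|)%N -> (2 <= #|A :\: C|)%N -> False.
  move=> S2 R2.
  have sub1 := lam_submod isoL (e |: A) (~: C); rewrite -ESC !lamC // in sub1.
  have E1 : (e |: A) :&: ~: C = A :\: C.
    apply/setP => v; rewrite !inE andbC; case: (eqVneq v e) => [->|_] //=.
    by rewrite (negPf eA) eC.
  rewrite E1 in sub1.
  have sub2 := lam_submod isoL A (~: C); rewrite -setDE in sub2.
  have E2 : A :|: ~: C = ~: (e |: S) by rewrite ES; apply/setP => v; rewrite !inE negb_and negbK.
  rewrite E2 !lamC // in sub2.
  have : (2 <= #|~: (A :\: C)|)%N.
    by apply: leq_trans C2 _; apply: subset_leq_card; apply/subsetP => v; rewrite !inE => ->.
  move=> /(lam_ge2 primeL R2) R2'.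
  have : (2 <= #|~: S|)%N.
    by apply: leq_trans A2 _; apply: subset_leq_card; apply/subsetP => v; rewrite !inE => ->; rewrite orbT.
  move=> /(lam_ge2 primeL S2) S2'.
  have := @lam_lt_setU1 t e f g a S (~: A) tt a0 ta oA' _ eS fS gS.
  have -> : e |: S \subset ~: A by rewrite ES; apply/subsetP => v; rewrite !inE => /andP[].
  by move=> /(_ isT) lt; move: lt sub1 sub2 R2' S2' lA lA' lC lC'; clear; lia.
have R1 : (1 <= #|A :\: C|)%N by rewrite card_gt0; apply/set0Pn; exists f; rewrite !inE fA fC.
have gQ : g \in ~: (A :|: C) by rewrite !inE negb_or gA gC.
case: (leqP #|~: (A :|: C)| 1) => Q2.
  (* Only [g] lies outside both sets, and [claim1] leaves one vertex in [S]: the side opposite to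
     [A] is a pair containing [g], which completes [e] to a triplet. *)
  have E1 : ~: (e |: A) = ~: (A :|: C) :|: S.
    apply/setP => v; rewrite !inE !negb_or; case: (eqVneq v e) => [->|_] /=; first by rewrite eC andbF.
    by case: (v \in A); case: (v \in C).
  have [Q1 cU1] : (#|~: (A :|: C)| <= 1 /\ #|~: (e |: A)| <= #|~: (A :|: C)| + #|S|)%N.
    by rewrite E1 cardsU leq_subr.
  have S1 : (1 <= #|S|)%N by move: A2' Q1 cU1; clear; lia.
  have E2 : ~: (f |: C) = ~: (A :|: C) :|: ((A :\: C) :\ f).
    apply/setP => v; rewrite !inE !negb_or; case: (eqVneq v f) => [->|_] /=; first by rewrite fA.
    by case: (v \in A); case: (v \in C).
  have R2 : (2 <= #|A :\: C|)%N.
    have := cardsD1 f (A :\: C); rewrite [f \in _]inE fA fC /=.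
    have : (#|~: (f |: C)| <= #|~: (A :|: C)| + #|(A :\: C) :\ f|)%N.
      by rewrite E2 cardsU leq_subr.
    by move: C2' Q1; clear; lia.
  have SS : #|S| = 1%N by case: (leqP 2 #|S|) => [/claim1/(_ R2)//|]; move: S1; clear; lia.
  have EQ : ~: (A :|: C) = [set g].
    by apply/eqP; rewrite eq_sym eqEcard sub1set gQ cards1.
  have /eqP/cards1P[x Sx] := SS; have xS : x \in S by rewrite Sx inE.
  have B2 : #|~: (e |: A)| = 2%N.
    by move: A2' cU1; rewrite EQ Sx !cards1; clear; lia.
  have eB : e \notin ~: (e |: A) by rewrite !inE eqxx.
  have := lam_le2_tri eB B2; rewrite setU1_compl // lamC // => /(_ lA')[y [z [E tr]]].
  have xf : x != f by apply: contraTneq xS => ->.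
  have yzf : y != f /\ z != f.
    have : f \notin ~: (e |: A) by rewrite !inE fA orbT.
    by rewrite E !inE negb_or ![f == _]eq_sym => /andP[].
  have: g \in [set y; z] by rewrite -E !inE negb_or ge.
  rewrite !inE => /orP[] /eqP Eg; subst g.
    by exists z; right; split; [case: yzf|].
  by exists y; right; split; [case: yzf | apply: tri_perm tr; exact: perm23].
have Q2' : 2 <= lam L (A :|: C).
  rewrite -lamC //; apply: lam_ge2 => //; rewrite setCK; apply: leq_trans A2 _.
  by apply: subset_leq_card; apply: subsetUl.
set P := A :&: C.
have eP : e \notin P by rewrite inE (negPf eA).
have fP : f \notin P by rewrite inE (negPf fC) andbF.
have gP : g \notin P by rewrite inE (negPf gA).
have efP : e \notin f |: P by rewrite in_setU1 negb_or ef.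
have sub1 := lam_submod isoL (e |: A) (f |: C).
have E1 : (e |: A) :|: (f |: C) = A :|: C.
  apply/setP => v; rewrite !inE; case: (eqVneq v e) => [->|_]; first by rewrite eC !orbT.
  by case: (eqVneq v f) => [->|_]; rewrite ?fA.
have E2 : (e |: A) :&: (f |: C) = e |: (f |: P).
  apply/setP => v; rewrite !inE; case: (eqVneq v e) => [->|_]; first by rewrite eC orbT.
  by case: (eqVneq v f) => [->|_]; rewrite ?fA.
rewrite E1 E2 in sub1.
have sub2 := lam_submod isoL (e |: A) C.
have E3 : (e |: A) :|: C = A :|: C.
  by apply/setP => v; rewrite !inE; case: (eqVneq v e) => [->|_] //; rewrite eC !orbT.
have E4 : (e |: A) :&: C = e |: P.
  by apply/setP => v; rewrite !inE; case: (eqVneq v e) => [->|_] //; rewrite eC.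
rewrite E3 E4 in sub2.
(* If [P] is empty, [claim1] makes [C] a pair containing [e]; if [P] is large, [sub2] contradicts
   [lam_lt_setU1]; if [P] is a single [w], [sub1] makes [e, f, w] a triplet. *)
case: (ltngtP #|P| 1%N) => P1.
- have P0 : P = set0 by apply/eqP; rewrite -cards_eq0; move: P1; clear; lia.
  have E5 : S = C :\ e.
    apply/setP => v; rewrite !inE negb_or -andbA; case: (boolP (v \in A)) => // vA.
    have : v \notin P by rewrite P0 inE.
    by rewrite inE vA /= => /negPf ->; rewrite !andbF.
  have S1 := cardsD1 e C; rewrite eC -E5 in S1.
  have R2 : (2 <= #|A :\: C|)%N by have := cardsID C A; rewrite -/P P0 cards0 add0n => ->.
  have C2e : #|C| = 2%N.
    by case: (leqP 2 #|S|) => [/claim1/(_ R2)//|]; move: S1 C2; clear; lia.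
  have [y [z [E tr]]] := lam_le2_tri fC C2e lC.
  have [yg zg] : y != g /\ z != g.
    by move: gC; rewrite E !inE negb_or ![g == _]eq_sym => /andP[].
  move: eC; rewrite E !inE => /orP[] /eqP Ee; subst e.
    by exists z; left; split=> //; apply: tri_perm tr; exact: perm12.
  exists y; left; split=> //; apply: tri_perm tr.
  by apply: perm_trans (perm23 _ _ _) (perm12 _ _ _).
- have cP : (2 <= #|~: P|)%N.
    by apply: leq_trans Q2 (subset_leq_card _); rewrite setCS; apply: subset_trans (subsetIl _ _) (subsetUl _ _).
  have P2 := lam_ge2 primeL P1 cP.
  have := @lam_lt_setU1 t e f g a P (e |: A) tt a0 ta oA _ eP fP gP.
  have -> : e |: P \subset e |: A by rewrite setUS // subsetIl.
  by move=> /(_ isT) lt; move: lt P2 sub2 lA lC' Q2'; clear; lia.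
- move/eqP/cards1P: P1 => [w Pw].
  have c2 : #|f |: P| = 2%N by rewrite cardsU1 fP Pw cards1.
  have [|y [z [E tr]]] := lam_le2_tri efP c2; first by move: sub1 lA lC Q2'; clear; lia.
  have [yg zg] : y != g /\ z != g.
    have: g \notin f |: P by rewrite inE negb_or gP inE gf.
    by rewrite E !inE negb_or ![g == _]eq_sym => /andP[].
  have: f \in [set y; z] by rewrite -E !inE eqxx.
  rewrite !inE => /orP[] /eqP Ef; subst f.
    by exists z; left.
  by exists y; left; split=> //; apply: tri_perm tr; exact: perm23.
Qed.

End Splits.

(** * Chains of triplets *)

Section Chains.
Local Open Scope ring_scope.
Variables (T : finType) (L : pred (pvec T)).
Hypothesis isoL : isotropic L.
Hypothesis primeL : prime_sys L.
Hypothesis T5 : (5 <= #|T|)%N.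
Implicit Types (t u s : pvec T) (X Y A B C Z : {set T}) (e f g h i v w x y : T) (p q : seq T).

(* Essential vertices have splits in two distinct directions [b]; equivalently one can
   be found that avoids any prescribed direction [c]. *)
Definition ess e := forall c : pauli,
  exists (b : pauli) (A : {set T}), [/\ b != 0, c != b & dsplit L e b A].

(** A section of the triplet not commuting with [t] at [e] would give it dimension 2, against
    primality; a vector of [L] vanishing at [f] and [g] meets [t] at most at [e]. *)
Lemma tri_dsplit t e f g : tvec L t e f g -> dsplit L e (t e) [set f; g].
Proof.
move=> tt; have [Lt U tE] := tt.
have [ef eg fg] : [/\ e != f, e != g & f != g].
  by move: U; rewrite /= !inE negb_or andbT => /andP[/andP[]].
have tr : tri L e f g by apply/(triP isoL primeL T5); exists t.
have E : e |: [set f; g] = [set e; f; g] by rewrite setUA.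
have c2 : #|[set f; g]| = 2%N by rewrite cards2 fg.
have c3 := cards3 U; have cC := cardsC [set e; f; g].
have c3' : (2 <= #|~: [set e; f; g]|)%N by lia.
have ne : e \notin [set f; g] by rewrite !inE negb_or ef eg.
split=> //.
- by rewrite c2 E.
- split; last by rewrite /lam c2; lia.
  by rewrite E /lam c3; case/andP: tr => _; lia.
- move=> u su; apply/eqP; apply: contraT => ou.
  have := dsec_grow2 isoL ne su _ ou; rewrite E => /(_ (tvec_sec tt)).
  have := primeL (X := [set e; f; g]); rewrite c3 => /(_ isT c3'); lia.
move=> u /secP[Lu su]; apply: (om_share1 isoL) => // w we.
case: (eqVneq (t w) 0) => tw; [by right | left; apply: su].
by move: tw; rewrite tE !inE negbK (negPf we).
Qed.

(** The two triplets give splits at [f] in the directions [s f] and [t f], which differ by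
    [om_share2]. This makes the second vertex of a chain of four essential. *)
Lemma tri_ess e f g h : tri L f g e -> tri L f g h -> e != h -> ess f.
Proof.
move=> /(triP isoL primeL T5)[s ts] /(triP isoL primeL T5)[t tt] eh c.
have := om_share2 isoL primeL T5 ts tt eh; have [Ls _ sE] := ts; have [Lt _ tE] := tt.
rewrite om_eq0 ?sE ?tE ?inE ?eqxx // => st.
case: (eqVneq c (s f)) => [->|cs].
  by exists (t f), [set g; h]; rewrite tE inE eqxx; split=> //; apply: tri_dsplit.
by exists (s f), [set g; e]; rewrite sE inE eqxx; split=> //; apply: tri_dsplit.
Qed.

Lemma ess_in_tri e : ess e -> exists x y : T, tri L e x y.
Proof.
move=> E; have [a [A [a0 _ sA]]] := E 0; have [b [B [b0 ab sB]]] := E a.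
by apply: dsplit2_tri a0 b0 ab sA sB.
Qed.

Lemma tri_next e f g : tri L e f g -> ess e -> ess f ->
  exists w : T, (w != g /\ tri L e f w) \/ (w != f /\ tri L e g w).
Proof.
move=> /(triP isoL primeL T5)[t tt] Ee Ef.
have [a [A [a0 ta sA]]] := Ee (t e); have [b [B [b0 tb sB]]] := Ef (t f).
exact: triangle tt a0 ta sA b0 tb sB.
Qed.

Definition chain p :=
  uniq p /\ forall x0 k, (k.+2 < size p)%N ->
    tri L (nth x0 p k) (nth x0 p k.+1) (nth x0 p k.+2).

(** Triplets are centred at every vertex but the last: those inside the chain, and one joining the
    first two vertices to the last. *)
Definition ring_chain p := [/\ chain p, (5 <= size p)%N
  & forall x0, tri L (nth x0 p 0) (nth x0 p 1) (nth x0 p (size p).-1)].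

Lemma chain_cons w x y p : chain [:: x, y & p] -> w \notin [:: x, y & p] ->
  tri L w x y -> chain [:: w, x, y & p].
Proof.
move=> [U H] wp tr; split=> [|x0 [|k]]; first by rewrite cons_uniq wp.
  by [].
by move=> lt; apply: (H x0 k).
Qed.

Lemma chain_rev p : chain p -> chain (rev p).
Proof.
move=> [U H]; split=> [|x0 k]; first by rewrite rev_uniq.
rewrite size_rev => lt; rewrite !nth_rev; [|lia..].
have := H x0 (size p - k.+3)%N.
have -> : (size p - k.+3).+1 = (size p - k.+2)%N by lia.
have -> : (size p - k.+2).+1 = (size p - k.+1)%N by lia.
by move=> tr; apply: tri_perm (tr _); rewrite ?perm13 //; lia.
Qed.

Lemma tri_neq e f g : tri L e f g -> [/\ e != f, e != g & f != g].
Proof. by case/andP; rewrite /= !inE negb_or andbT => /andP[/andP[]]. Qed.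

(** * Extending chains on at least six vertices *)

Section LargeEnough.
Hypothesis T6 : (6 <= #|T|)%N.

(** By [om_share2], adding [e] raises the dimension of [{f, g, h}] by two; four vertices carrying
    three dimensions contradict primality. *)
Lemma no_tri4 e f g h : tri L f g h -> tri L e f g -> tri L e f h -> False.
Proof.
move=> t1 t2 t3; have [ef eg fg] := tri_neq t2.
have [_ eh fh] := tri_neq t3; have [_ _ gh] := tri_neq t1.
have ne : e \notin [set f; g; h] by rewrite !inE !negb_or ef eg eh.
move/(triP isoL primeL T5): t2 => [s ts]; move/(triP isoL primeL T5): t3 => [t tt].
have := dsec_grow2 isoL ne _ _ (om_share2 isoL primeL T5 ts tt gh).
have ss : sec L (e |: [set f; g; h]) s.
  by apply: secS (tvec_sec ts); apply/subsetP => v; rewrite !inE => /orP[/orP[]|] ->; rewrite ?orbT.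
have st : sec L (e |: [set f; g; h]) t.
  by apply: secS (tvec_sec tt); apply/subsetP => v; rewrite !inE => /orP[/orP[]|] ->; rewrite ?orbT.
move=> /(_ ss st).
have c4 : #|e |: [set f; g; h]| = 4%N.
  by rewrite cardsU1 ne cards3 //; case/andP: t1.
have cC := cardsC (e |: [set f; g; h]).
have := primeL (X := e |: [set f; g; h]).
by case/andP: t1 => _; lia.
Qed.

(** A new [w] lengthens the chain. Otherwise [w] lies beyond [g]; it is not [h] by [no_tri4], nor a
    later vertex with a successor, so it is the last one and closes the ring. *)
Lemma extend_adjacent e f g h q w : chain [:: e, f, g, h & q] ->
  tri L e f w -> w != g ->
  (exists p, chain p /\ size p = (size q + 5)%N) \/ (exists p, ring_chain p).
Proof.
set p := [:: e, f, g, h & q] => ch tr wg; have [U H] := ch.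
have [ef ew fw] := tri_neq tr.
case: (boolP (w \in p)) => wp; last first.
  left; exists (w :: p); split; last by rewrite /= !addnS addn0.
  by apply: chain_cons => //; apply: tri_perm tr; apply: perm_trans (perm23 _ _ _) (perm12 _ _ _).
have := index_mem w p; rewrite wp; have := nth_index e wp; move: (index w p) => j wE jp.
case: j wE jp => [|[|[|[|j]]]] /= wE jp; try by move: ew fw wg; rewrite -wE eqxx.
  have := no_tri4 (H e 1%N isT) (H e 0%N isT); rewrite -wE in tr; by move=> /(_ tr).
have {}wE : nth e p j.+4 = w by [].
case: (leqP (size p) j.+4.+1) => jl; last first.
  (* The vector [s] meets two consecutive triplet vectors of the chain only at [w], so both agree
     with [s] there; but they share two vertices, hence differ at [w]. *)
  exfalso; have tr1 := H e j.+3 jl; have tr2 := H e j.+2 (ltnW jl).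
  have {tr2} tr2 := tri_perm (perm13 _ _ _) tr2.
  have {tr1} tr1 := tri_perm (perm12 _ _ _) tr1.
  rewrite wE in tr1 tr2; have ne : nth e p j.+4.+1 != nth e p j.+2.
    have lt2 : (j.+2 < j.+4.+1)%N by clear; lia.
    by rewrite nth_uniq ?(ltn_trans lt2) // neq_ltn lt2 orbT.
  move/(triP isoL primeL T5): tr => [s ts].
  move/(triP isoL primeL T5): tr1 => [t1 tt1].
  move/(triP isoL primeL T5): tr2 => [t2 tt2].
  have [Ls _ sE] := ts; have [Lt1 _ tE1] := tt1; have [Lt2 _ tE2] := tt2.
  have nz k : (2 <= k)%N -> (k < size p)%N -> (e != nth e p k) && (f != nth e p k).
    move=> k2 kp; apply/andP; split.
      by rewrite -[X in X != _]/(nth e p 0) nth_uniq // neq_ltn (ltnW k2).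
    by rewrite -[X in X != _]/(nth e p 1) nth_uniq // neq_ltn k2.
  have [w0 w1 w2] : [/\ s w != 0, t1 w != 0 & t2 w != 0].
    by rewrite sE tE1 tE2 !inE eqxx !orbT.
  have share t x y : L t -> (forall v, (t v != 0) = (v \in [:: w; x; y])) ->
      (e != x) && (f != x) -> (e != y) && (f != y) -> s w = t w.
    move=> Lt tE /andP[ex fx] /andP[ey fy].
    apply/eqP; rewrite -om_eq0 ?sE ?tE ?inE ?eqxx ?orbT //; apply/eqP/(om_share1 isoL) => // v vw.
    case: (eqVneq (s v) 0) => sv; [by left | right; apply/eqP].
    move: sv; rewrite sE -[_ == _]negbK tE !inE (negPf vw) orbF /= => /orP[] /eqP ->.
      by rewrite (negPf ex) (negPf ey).
    by rewrite (negPf fx) (negPf fy).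
  have E1 := share t1 _ _ Lt1 tE1 (nz j.+3 isT (ltnW (ltnW jl))) (nz j.+4.+1 isT jl).
  have E2 := share t2 _ _ Lt2 tE2 (nz j.+3 isT (ltnW (ltnW jl))) (nz j.+2 isT (ltnW (ltnW (ltnW jl)))).
  by have := om_share2 isoL primeL T5 tt1 tt2 ne; rewrite -E1 -E2 omaa eqxx.
have jsize : (j.+4 < size p)%N by exact: jp.
right; exists p; split=> // [|x0]; first exact: (leq_trans _ jsize).
have <- : j.+4 = (size p).-1 by move: jl jsize; clear; lia.
by rewrite (set_nth_default e x0 jsize) wE.
Qed.

Lemma tri_compl e f g h i x : #|T| = 6%N -> uniq [:: e; f; g; h; i; x] ->
  tri L e f g -> tri L h i x.
Proof.
move=> T6e U tr; have U3 : uniq [:: h; i; x].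
  by move: U; rewrite -[[:: e; f; g; h; i; x]]/([:: e; f; g] ++ [:: h; i; x]) cat_uniq => /and3P[].
rewrite /tri U3; have -> : [set h; i; x] = ~: [set e; f; g].
  apply/eqP; rewrite eqEcard cards3 //.
  have := cardsC [set e; f; g]; rewrite cards3; last by case/andP: tr.
  rewrite T6e => cC; rewrite andbC; apply/andP; split; first by lia.
  apply/subsetP => v vh; rewrite inE; apply: contraL U => ve.
  rewrite -[[:: e; f; g; h; i; x]]/([:: e; f; g] ++ [:: h; i; x]) cat_uniq.
  rewrite negb_and orbC negb_and negbK; apply/orP; left; apply/orP; left.
  apply/hasP; exists v; [move: vh | move: ve]; by rewrite !inE orbA.
have := lamC isoL [set e; f; g]; have := cardsC [set e; f; g].
by case/andP: tr => Ue; rewrite /lam cards3 // T6e /=; lia.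
Qed.

(* Such a configuration forces five vertices to carry four independent vectors,
   so there are only six vertices and complements of triplets are triplets. *)
Lemma extend_skip e f g h i q w : chain [:: e, f, g, h, i & q] ->
  tri L e g w -> w != f -> exists p, ring_chain p.
Proof.
move=> [U H] tr wf.
have tr1 : tri L e f g := H e 0%N isT.
have tr2 : tri L f g h := H e 1%N isT.
have tr3 : tri L g h i := H e 2 isT.
have U5 : uniq [:: e; f; g; h; i].
  by move: U; rewrite -[[:: e, f, g, h, i & q]]/([:: e; f; g; h; i] ++ q) cat_uniq => /andP[].
move: (U5); rewrite /= !inE !negb_or !andbT => /and4P[/and4P[ef eg eh ei] /and3P[fg fh fi] /andP[gh gi] hi].
have /(triP isoL primeL T5)[s ts] := tr.
have /(triP isoL primeL T5)[t1 tt1] := tr1.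
have /(triP isoL primeL T5)[t3 tt3] := tr3.
have [Ls _ sE] := ts; have [Lt1 _ tE1] := tt1; have [Lt3 _ tE3] := tt3.
(* [t1] and [t3] meet only at [g] and agree there, while [s] and [t1] also share [e] and so differ
   at [g]. Hence [s] and [t3] must meet again, which makes [w] one of [h], [i]. *)
have E13 : t1 g = t3 g.
  apply/eqP; rewrite -om_eq0 ?tE1 ?tE3 ?inE ?eqxx ?orbT //; apply/eqP/(om_share1 isoL) => // v vg.
  case: (eqVneq (t1 v) 0) => sv; [by left | right; apply/eqP].
  move: sv; rewrite tE1 -[_ == _]negbK tE3 !inE (negPf vg) orbF /= => /orP[] /eqP ->.
    by rewrite (negPf eh) (negPf ei).
  by rewrite (negPf fh) (negPf fi).
have os : om (s g) (t3 g) != 0.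
  have := om_share2 isoL primeL T5 (tvec_perm (perm12 _ _ _) ts).
  rewrite -E13 => /(_ _ _ (tvec_perm (perm_trans (perm23 _ _ _) (perm12 _ _ _)) tt1)).
  exact.
have wS : w \in [set h; i].
  apply: contraNT os => wS; apply/eqP/(om_share1 isoL) => // v vg.
  case: (eqVneq (s v) 0) => sv; [by left | right; apply/eqP].
  move: sv; rewrite sE -[_ == _]negbK tE3 !inE (negPf vg) /= => /orP[] /eqP ->.
    by rewrite (negPf eh) (negPf ei).
  by move: wS; rewrite !inE.
have oe : om (s e) (t1 e) != 0.
  have tt1' := tvec_perm (perm23 e f g) tt1.
  by have := om_share2 isoL primeL T5 ts tt1' wf.
set X3 := [set f; g; h]; set X4 := i |: X3; set X5 := e |: X4.
have c3 : #|X3| = 3%N by apply: cards3; case/andP: tr2.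
have i3 : i \notin X3 by rewrite !inE !negb_or ![i == _]eq_sym fi gi hi.
have e4 : e \notin X4 by rewrite !inE !negb_or ef eg eh ei.
have d3 : (0 < dsec L X3)%N by case/andP: tr2.
have d4 : (dsec L X3 < dsec L X4)%N.
  apply: (@dsec_grow T L isoL i X3 t3 i3); last by rewrite tE3 !inE eqxx !orbT.
  by apply: secS (tvec_sec tt3); apply/subsetP => v; rewrite !inE => /orP[/orP[]|] ->; rewrite ?orbT.
have d5 : (dsec L X4 + 2 <= dsec L X5)%N.
  apply: (@dsec_grow2 T L isoL e X4 s t1 e4 _ _ oe).
    apply: secS (tvec_sec ts); apply/subsetP => v; rewrite !inE => /orP[/orP[]|] /eqP ->; rewrite ?eqxx ?orbT //.
    by move: wS; rewrite !inE => /orP[] ->; rewrite ?orbT.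
  by apply: secS (tvec_sec tt1); apply/subsetP => v; rewrite !inE => /orP[/orP[]|] ->; rewrite ?orbT.
have c5 : #|X5| = 5%N by rewrite !cardsU1 e4 i3 c3.
have cC := cardsC X5; have P5 := primeL (X := X5).
have cC1 : #|~: X5| = 1%N by move: P5 d3 d4 d5 cC c5 T6; clear; lia.
have T6e : #|T| = 6%N by move: cC c5 cC1; clear; lia.
have /eqP/cards1P[x xE] := cC1.
have xX : x \notin X5 by rewrite -in_setC xE inE.
have U6 : uniq [:: e; f; g; h; i; x].
  rewrite -[X in uniq X]/(rcons [:: e; f; g; h; i] x) rcons_uniq U5 andbT.
  by apply: contra xX; rewrite !inE => /or4P[||| /orP[]] ->; rewrite ?orbT.
have trx : tri L h i x := tri_compl T6e U6 tr1.
have trx' : tri L e i x.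
  apply: tri_compl T6e _ tr2; rewrite (perm_uniq (s2 := [:: e; f; g; h; i; x])) //.
  exact: (permEl (perm_catCA [:: f; g; h] [:: e] [:: i; x])).
(* The triplet [h, i, x] is the complement of [e, f, g], and the closing one [e, i, x] that of
   [f, g, h]. *)
exists [:: x; i; h; g; f; e]; split=> // [|x0]; last first.
  exact: tri_perm (perm13 _ _ _) trx'.
split=> [|x0 [|[|[|[|//]]]] _ /=].
- exact: (etrans (rev_uniq [:: e; f; g; h; i; x]) U6).
- exact: tri_perm (perm13 _ _ _) trx.
- exact: tri_perm (perm13 _ _ _) tr3.
- exact: tri_perm (perm13 _ _ _) tr2.
- exact: tri_perm (perm13 _ _ _) tr1.
Qed.

(** The first two vertices are essential, so [tri_next] supplies a triplet on [e, f] or on [e, g].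
    In a chain of exactly four vertices [f] and [g] can be exchanged, which reduces the second case
    to the first. *)
Lemma extend x0 p : chain p -> (4 <= size p)%N -> ess (nth x0 p 0) ->
  (exists q, chain q /\ size q = (size p).+1) \/ (exists q, ring_chain q).
Proof.
case: p => [|e [|f [|g [|h q]]]] // ch _ Ee; have [U H] := ch.
have t1 : tri L e f g := H e 0%N isT; have t2 : tri L f g h := H e 1%N isT.
have eh : e != h by move: U; rewrite /= !inE !negb_or => /andP[/and4P[]].
have Ef : ess f.
  apply: tri_ess t2 eh; apply: tri_perm t1.
  exact: perm_trans (perm12 _ _ _) (perm23 _ _ _).
have sz : (size [:: e, f, g, h & q]).+1 = (size q + 5)%N by rewrite /= !addnS addn0.
rewrite sz; have [w [[wg tr]|[wf tr]]] := tri_next t1 Ee Ef.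
  exact: extend_adjacent ch tr wg.
case: q Ee ch U H sz => [|i q] Ee ch U H sz; last by right; apply: extend_skip ch tr wf.
apply: (@extend_adjacent e g f h [::] w) => //; split=> [|y [|[|//]] _ /=].
- by rewrite (perm_uniq (s2 := [:: e; f; g; h])) // perm_cons perm12.
- exact: tri_perm (perm23 _ _ _) t1.
- exact: tri_perm (perm12 _ _ _) t2.
Qed.

Section TwoNonEssential.
Variable ne : pred T.
Hypothesis neP : forall v, ~~ ne v -> ess v.

(** [m] bounds how often the chain can still grow. One of its two ends is essential, and reversal
    brings that end to the front. *)
Lemma grow_chain m p : (forall x y, x != y -> ~~ ne x \/ ~~ ne y) ->
  (#|T| < size p + m)%N -> chain p -> (4 <= size p)%N -> exists q, ring_chain q.
Proof.
move=> two; elim: m p => [|m IHm] p szm ch p4.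
  have [U _] := ch; move: szm; rewrite addn0 ltnNge; case/negP.
  by rewrite -(card_uniqP U) max_card.
have x0 : T by case: p p4 {ch szm}.
have [U H] := ch; have p1 : (0 < size p)%N by apply: leq_trans p4.
have ends : nth x0 p 0 != nth x0 (rev p) 0.
  rewrite nth_rev // subn1 nth_uniq ?prednK // neq_ltn; apply/orP; left.
  by move: p4; clear; lia.
have next q : chain q -> size q = (size p).+1 -> exists r, ring_chain r.
  by move=> chq sq; apply: (IHm q) => //; rewrite sq ?addSnnS // (leq_trans p4).
case: (two _ _ ends) => /neP.
  by case/(extend ch p4) => // -[q [chq sq]]; apply: next sq.
have rp4 : (4 <= size (rev p))%N by rewrite size_rev.
case/(extend (chain_rev ch) rp4) => // -[q [chq sq]]; apply: next chq _.
by rewrite sq size_rev.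
Qed.

Lemma ring_or_two_large :
  (exists p, ring_chain p) \/ (exists x y : T, [/\ x != y, ne x & ne y]).
Proof.
case: (boolP [exists x, exists y, [&& x != y, ne x & ne y]]) => [|no].
  by case/existsP => x /existsP[y /and3P[]]; right; exists x, y.
have two x y : x != y -> ~~ ne x \/ ~~ ne y.
  move=> xy; apply/orP; rewrite -negb_and; apply: contra no => /andP[nx ny].
  by apply/existsP; exists x; apply/existsP; exists y; rewrite xy nx.
(* With at most one non-essential vertex, some triplet [v, a, b] has [v] and one other vertex
   essential; the triangle lemma then puts a fourth vertex before [v]. *)
left; suff [p [ch p4]] : exists p, chain p /\ (4 <= size p)%N.
  by apply: (@grow_chain #|T|.+1 p) => //; move: p4; clear; lia.
have [x [y xy]] : exists x y : T, x != y.
  have : (1 < #|T|)%N by apply: leq_trans T6.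
  by case/card_gt1P => x [y [_ _]]; exists x, y.
have [v vess] : exists v, ess v by case: (two _ _ xy) => /neP; [exists x | exists y].
have [a [b tr]] := ess_in_tri vess; have [va vb ab] := tri_neq tr.
wlog aess : a b tr va vb ab / ess a.
  move=> W; case: (two _ _ ab) => /neP; first exact: W tr va vb ab.
  by apply: (W b a) => //; [apply: tri_perm tr; exact: perm23 | rewrite eq_sym].
have [w [[wb tw]|[wa tw]]] := tri_next tr vess aess.
  exists [:: w; v; a; b]; split=> //; have [_ vw aw] := tri_neq tw.
  split=> [|x0 [|[|//]] _ /=].
  - by rewrite /= !inE !negb_or ![w == _]eq_sym vw aw [b == _]eq_sym wb va vb ab.
  - by apply: tri_perm tw; rewrite (perm_catC [:: v; a] [:: w]).
  - exact: tr.
exists [:: w; v; b; a]; split=> //; have [_ vw bw] := tri_neq tw.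
split=> [|x0 [|[|//]] _ /=].
- by rewrite /= !inE !negb_or ![w == _]eq_sym vw bw [a == w]eq_sym wa va vb [b == _]eq_sym ab.
- by apply: tri_perm tw; rewrite (perm_catC [:: v; b] [:: w]).
- by apply: tri_perm tr; exact: perm23.
Qed.

End TwoNonEssential.
End LargeEnough.

(** The triple has the [lam] of the complementary pair, which is at most 2. Any ordering of five
    vertices is then a ring. *)
Lemma tri_card5 e f g : #|T| = 5%N -> uniq [:: e; f; g] -> tri L e f g.
Proof.
move=> T5e U; rewrite /tri U /=; have := lamC isoL [set e; f; g].
have := cardsC [set e; f; g]; rewrite /lam cards3 // T5e; lia.
Qed.

Lemma ring_or_two (ne : pred T) : (forall v, ~~ ne v -> ess v) ->
  (exists p, ring_chain p) \/ (exists x y : T, [/\ x != y, ne x & ne y]).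
Proof.
move=> neP; case: (leqP 6 #|T|) => [T6|T6]; first exact: ring_or_two_large.
have T5e : #|T| = 5%N by apply/eqP; rewrite eqn_leq T5 -ltnS T6.
have sz : size (enum T) = 5%N by rewrite -cardE.
have U := enum_uniq T.
have T3 x0 (i j k : nat) : (i < 5)%N -> (j < 5)%N -> (k < 5)%N -> uniq [:: i; j; k] ->
  tri L (nth x0 (enum T) i) (nth x0 (enum T) j) (nth x0 (enum T) k).
  move=> i5 j5 k5 Ui; apply: tri_card5 => //.
  rewrite -[X in uniq X]/(map (nth x0 (enum T)) [:: i; j; k]) map_inj_in_uniq //.
  move=> a b; rewrite !inE => aS bS /eqP; rewrite nth_uniq ?sz // => [/eqP //||].
    by case/or3P: aS => /eqP ->.
  by case/or3P: bS => /eqP ->.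
left; exists (enum T); split=> [||x0]; rewrite ?sz //; last exact: T3.
split=> // x0 k; rewrite sz => k3; apply: T3 => //; try by apply: leq_trans k3; rewrite ltnS.
  by apply: leq_trans k3; rewrite !ltnS -addn2 leq_addr.
by clear; rewrite /= !inE; lia.
Qed.

End Chains.

(** * The isotropic system of a graph *)

Section GraphSystem.
Local Open Scope ring_scope.
Variable T : finType.
Implicit Types (G H : sgraph T) (x y : pvec T) (X Y A B : {set T}) (u v w : T).

Definition nbr_sum G x v : 'F_2 := \sum_u (G u v)%:R * ((x u).1 : 'F_2).

Definition graph_sys G : pred (pvec T) :=
  fun x => [forall v, (x v).2 == nbr_sum G x v].

Lemma graph_sysP G x : reflect (forall v, (x v).2 = nbr_sum G x v) (graph_sys G x).
Proof. by apply: (iffP forallP) => H v; apply/eqP. Qed.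

Lemma eq_graph_sys G H : G =2 H -> graph_sys G =1 graph_sys H.
Proof.
move=> E x; apply: eq_forallb => v; rewrite /nbr_sum.
by congr (_ == _); apply: eq_bigr => u _; rewrite E.
Qed.

Lemma nbr_sumD G x y v : nbr_sum G (x + y) v = nbr_sum G x v + nbr_sum G y v.
Proof. by rewrite -big_split; apply: eq_bigr => u _; rewrite ffunE mulrDr. Qed.

(** Isotropy is the symmetry of adjacency; membership is [#|T|] linear conditions in dimension
    [#|T| * 2]. *)
Lemma graph_sys_isotropic G : isotropic (graph_sys G).
Proof.
have sub : subgroupP (graph_sys G).
  split=> [|x y /graph_sysP Hx /graph_sysP Hy]; apply/graph_sysP => v.
    by rewrite ffunE /nbr_sum big1 // => u _; rewrite ffunE mulr0.
  by rewrite ffunE nbr_sumD -Hx -Hy.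
split=> // [x y /graph_sysP Hx /graph_sysP Hy|].
  rewrite /form /om big_split /= sumrN; apply/eqP; rewrite subr_eq0; apply/eqP.
  under eq_bigr => v _ do rewrite Hy /nbr_sum mulr_sumr.
  rewrite exchange_big; apply: eq_bigr => v _; rewrite Hx /nbr_sum mulr_suml.
  by apply: eq_bigr => u _; rewrite adj_sym mulrCA mulrA.
pose f x : {ffun T -> ('F_2)^o} := [ffun v => (x v).2 - nbr_sum G x v].
have sT : subgroupP (xpredT : pred (pvec T)) by [].
have := @dm_ker T _ f xpredT (graph_sys G) sT sub.
have -> : dm (xpredT : pred (pvec T)) = (#|T| * 2)%N.
  have -> : dm (xpredT : pred (pvec T)) = \dim {: pvec T}.
    by congr (\dim _); apply/vspaceP => x; rewrite mem_vsub // memvf.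
  by rewrite dimvf.
rewrite /dim /= muln1 muln2 -addnn leq_add2r; apply.
  by move=> x y; apply/ffunP => v; rewrite !ffunE nbr_sumD opprD addrACA.
move=> x _ /ffunP H; apply/graph_sysP => v; have := H v; rewrite !ffunE => /eqP.
by rewrite subr_eq0 => /eqP.
Qed.

(* Local complementation at [v] exchanges Y and Z at [v], and X and Y at its
   neighbours. *)
Definition lc_pauli G v u (a : pauli) : pauli :=
  if u == v then (a.1 + a.2, a.2) else if G v u then (a.1, a.2 + a.1) else a.

Definition lc_vec G v x : pvec T := [ffun u => lc_pauli G v u (x u)].

Lemma lc_pauliK G v u : involutive (lc_pauli G v u).
Proof.
move=> a; rewrite /lc_pauli; case: eqP => _; [|case: (G v u) => //];
by elim/pauli_cases: a; apply/eqP.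
Qed.

Lemma om_lc G v u a b : om (lc_pauli G v u a) (lc_pauli G v u b) = om a b.
Proof.
rewrite /lc_pauli; case: eqP => _; [|case: (G v u) => //];
by elim/pauli_cases: a; elim/pauli_cases: b; apply/eqP.
Qed.

Lemma lc_pauli_eq0 G v u a : (lc_pauli G v u a == 0) = (a == 0).
Proof.
by rewrite /lc_pauli; case: (u =P v) => _; [|case: (G v u) => //]; elim/pauli_cases: a.
Qed.

Lemma lc_pauliD G v u a b :
  lc_pauli G v u (a + b) = lc_pauli G v u a + lc_pauli G v u b.
Proof.
rewrite /lc_pauli; case: eqP => _; [|case: (G v u) => //];
by elim/pauli_cases: a; elim/pauli_cases: b; apply/eqP.
Qed.

Lemma local_compl_nbr G v u : local_compl G v v u = G v u.
Proof. by rewrite /= /loc_adj adj_irr /= andbF addbF. Qed.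

Lemma local_complK G v : local_compl (local_compl G v) v =2 G.
Proof.
move=> a b; rewrite -[LHS]/(loc_adj (local_compl G v) v a b) /loc_adj.
by rewrite !local_compl_nbr /= /loc_adj addbK.
Qed.

Lemma graph_sys_lc G v x : graph_sys G x -> graph_sys (local_compl G v) (lc_vec G v x).
Proof.
move=> /graph_sysP Hx; apply/graph_sysP => u.
have F2 (a : 'F_2) : a + a = 0 by case: (F2_cases a) => ->; apply/eqP.
have E w : (lc_vec G v x w).1 = (x w).1 + (w == v)%:R * (x v).2.
  by rewrite ffunE /lc_pauli; case: eqP => [->|_]; [rewrite mul1r | rewrite mul0r addr0; case: ifP].
have adjE w : (local_compl G v w u)%:R =
    (G w u)%:R + [&& w != u, G v w & G v u]%:R :> 'F_2.
  by rewrite /= /loc_adj; case: (G w u); case: [&& _, _ & _] => //=; apply/eqP.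
rewrite /nbr_sum; under eq_bigr => w _ do rewrite E adjE mulrDl !mulrDr.
rewrite !big_split /= -/(nbr_sum G x u) -Hx.
have -> : \sum_w (G w u)%:R * ((w == v)%:R * (x v).2) = (G v u)%:R * (x v).2 :> 'F_2.
  rewrite (bigD1 v) //= eqxx mul1r big1 ?addr0 // => w /negPf ->.
  by rewrite mul0r mulr0.
have -> : \sum_w [&& w != u, G v w & G v u]%:R * ((w == v)%:R * (x v).2) = 0 :> 'F_2.
  apply: big1 => w _; case: (eqVneq w v) => [->|_]; last by rewrite mul0r mulr0.
  by rewrite adj_irr /= andbF mul0r.
rewrite addr0 ffunE /lc_pauli; case: (eqVneq u v) => [->|uv].
  rewrite adj_irr mul0r addr0 big1 ?addr0 // => w _.
  by rewrite !andbF mul0r.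
case Gvu : (G v u); last first.
  by rewrite mul0r addr0 big1 ?addr0 // => w _; rewrite !andbF mul0r.
rewrite mul1r /= -addrA; congr (_ + _).
(* The complemented edges at [u] contribute [(x v).2] without the term of [u]; the new first
   component at [v] cancels [(x v).2], leaving [(x u).1]. *)
have S : \sum_w [&& w != u, G v w & true]%:R * (x w).1 = nbr_sum G x v - (x u).1 :> 'F_2.
  rewrite /nbr_sum (bigD1 u) //= eqxx mul0r add0r [in RHS](bigD1 u) //=.
  rewrite adj_sym Gvu mul1r addrAC subrr add0r; apply: eq_bigr => w ->.
  by rewrite andbT adj_sym.
rewrite S -Hx addrA F2 add0r.
by case: (F2_cases (x u).1) => ->; apply/eqP.
Qed.

Lemma graph_sys_lcV G v x : graph_sys (local_compl G v) x -> graph_sys G (lc_vec G v x).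
Proof.
move=> /(graph_sys_lc v); rewrite (eq_graph_sys (local_complK G v)).
suff -> : lc_vec (local_compl G v) v x = lc_vec G v x by [].
by apply/ffunP => u; rewrite !ffunE /lc_pauli local_compl_nbr.
Qed.

End GraphSystem.

(** * Non-prime minors as splits of the isotropic system *)

Section Minors.
Local Open Scope ring_scope.
Variable T : finType.
Implicit Types (G H : sgraph T) (x y z : pvec T) (X Y A B : {set T}) (u v w e : T)
  (L : pred (pvec T)) (a : pauli).

Lemma dm_inj (P Q : pred (pvec T)) (f : pvec T -> pvec T) :
  subgroupP P -> subgroupP Q -> {morph f : x y / x + y} ->
  (forall x, f x = 0 -> x = 0) -> (forall x, P x -> Q (f x)) -> (dm P <= dm Q)%N.
Proof.
move=> sP sQ /lfun_of[g gE] f0 PQ; rewrite /dm -(limg_dim_eq (f := g)).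
  apply/dimvS/subvP => y /memv_imgP[x xP ->].
  by rewrite gE mem_vsub //; apply: PQ; rewrite -mem_vsub.
apply/eqP; rewrite -subv0; apply/subvP => x; rewrite memv_cap memv_ker gE memv0.
by case/andP => _ /eqP/f0 ->.
Qed.

(** A cut with too many sections is a split: given an edge [a b] across it, the candidate sets are
    neighbourhoods of [b] and [a], and a pair [c, y] violating the product rule makes the adjacency
    block on [a, c] and [b, y] invertible. *)
Lemma prime_graph_sys G : prime_graph G -> prime_sys (graph_sys G).
Proof.
move=> Gp X X2 cX2; rewrite leqNgt; apply: contraL Gp => dX; rewrite negbK.
have isoG := graph_sys_isotropic G.
apply/existsP; exists X; apply/existsP; exists (~: X).
rewrite /is_split setUCr eqxx leq_min X2 cX2 -setI_eq0 setICr eqxx /=.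
case: (boolP [exists a in X, exists b in ~: X, G a b]) => [|noE]; last first.
  apply/existsP; exists set0; apply/existsP; exists set0; rewrite !sub0set /=.
  apply/forall_inP => x xX; apply/forall_inP => y yX; rewrite !inE.
  rewrite eqbF_neg; apply: contra noE => Gxy.
  by apply/exists_inP; exists x => //; apply/exists_inP; exists y.
case/exists_inP => a aX /exists_inP[b bX Gab].
apply/existsP; exists [set x in X | G x b]; apply/existsP; exists [set y in ~: X | G a y].
have -> : [set x in X | G x b] \subset X by apply/subsetP => x; rewrite inE => /andP[].
have -> /= : [set y in ~: X | G a y] \subset ~: X by apply/subsetP => x; rewrite inE => /andP[].
apply/forall_inP => c cX; apply/forall_inP => y yX.
have -> : c \in [set x in X | G x b] = G c b by rewrite inE cX.
have -> : y \in [set y in ~: X | G a y] = G a y by rewrite inE yX.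
apply: contraLR dX => bad; rewrite -leqNgt.
have ca : c != a by apply: contra bad => /eqP ->; rewrite Gab.
(* A section of [X] vanishes at [b] and [y], so by invertibility its first components on [S]
   determine it, leaving at most [#|X| - 2] dimensions. *)
pose S := X :\ a :\ c.
have cS : (#|S| + 2 = #|X|)%N.
  by have := cardsD1 a X; have := cardsD1 c (X :\ a); rewrite -/S aX !inE ca cX /=; clear; lia.
rewrite -cS leq_add2r.
pose f x : {ffun {u | u \in S} -> ('F_2)^o} := [ffun u => (x (val u)).1].
have := @dm_ker T _ f (sec (graph_sys G) X) (pred1 0) (sec_subgroup isoG X) (pred1_subgroup T).
rewrite dm_pred1 add0n /dim /= muln1 card_sig; apply.
  by move=> x z; apply/ffunP => u; rewrite !ffunE.
move=> z /secP[/graph_sysP Lz zX] /ffunP fz.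
have z1 u : u != a -> u != c -> (z u).1 = 0.
  move=> ua uc; case: (boolP (u \in X)) => [uX|/zX -> //].
  have uS : u \in S by rewrite !inE uc ua.
  by have := fz (exist _ u uS); rewrite !ffunE.
have sumE w : nbr_sum G z w = (G a w)%:R * (z a).1 + (G c w)%:R * (z c).1.
  rewrite /nbr_sum (bigD1 a) //= (bigD1 c) //= big1 ?addr0 // => u /andP[ua uc].
  by rewrite z1 // mulr0.
have Eb : nbr_sum G z b = 0 by rewrite -Lz zX //; move: bX; rewrite inE.
have Ey : nbr_sum G z y = 0 by rewrite -Lz zX //; move: yX; rewrite inE.
have [za zc] : (z a).1 = 0 /\ (z c).1 = 0.
  move: Eb Ey bad; rewrite !sumE Gab.
  case: (F2_cases (z a).1) => ->; case: (F2_cases (z c).1) => -> //;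
  by case: (G c b); case: (G a y); case: (G c y) => // /eqP + /eqP.
have z1' u : (z u).1 = 0.
  by case: (eqVneq u a) => [->//|ua]; case: (eqVneq u c) => [->//|uc]; apply: z1.
apply/eqP/ffunP => u; rewrite ffunE; move: (Lz u) (z1' u); rewrite sumE za zc !mulr0 addr0.
by case: (z u) => p q /= -> ->.
Qed.

Definition dirsec L e a X : pred (pvec T) :=
  fun x => sec L (e |: X) x && (om (x e) a == 0).

(** A split of the minor has cut-rank at most 1, counted from either side; [dirsec] keeps the value
    at [e] instead of forgetting it. *)
Definition minor_split L e a A :=
  [/\ e \notin A, (2 <= #|A|)%N, (2 <= #|~: (e |: A)|)%N,
      (#|A| <= (dm (dirsec L e a A)).+1)%N
    & (#|~: (e |: A)| <= (dm (dirsec L e a (~: (e |: A)))).+1)%N].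

(** Primality bounds the dimension of all sections of [e |: X] by [#|X| - 1], which [dirsec] already
    attains, so every section lies in [dirsec]. *)
Lemma minor_split_dsplit L e a A : isotropic L -> prime_sys L ->
  minor_split L e a A -> dsplit L e a A.
Proof.
move=> isoL primeL [eA A2 B2 dA dB].
have half X : e \notin X -> (2 <= #|X|)%N -> (2 <= #|~: (e |: X)|)%N ->
    (#|X| <= (dm (dirsec L e a X)).+1)%N ->
    lam L (e |: X) <= 2 /\ (forall z, sec L (e |: X) z -> om (z e) a = 0).
  move=> eX X2 Y2 dX.
  have le : (dm (dirsec L e a X) <= dsec L (e |: X))%N.
    by apply: dm_mono; [apply: sec_om_subgroup|apply: sec_subgroup|move=> x /andP[]].
  have cX : #|e |: X| = #|X|.+1 by rewrite cardsU1 eX.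
  split=> [|u su]; first by move: le dX; rewrite /lam cX; clear; lia.
  apply/eqP; apply: contraT => ou.
  have : (dm (dirsec L e a X) < dsec L (e |: X))%N.
    apply: (@dm_strict _ _ _ u) => //; [apply: sec_om_subgroup|apply: sec_subgroup| |] => //.
      by move=> x /andP[].
    by rewrite /dirsec su.
  have := primeL (e |: X); rewrite cX.
  by move: dX X2 Y2; clear; lia.
have [l1 o1] := half A eA A2 B2 dA.
have eB : e \notin ~: (e |: A) by rewrite !inE eqxx.
have [l2 o2] : lam L (e |: ~: (e |: A)) <= 2 /\
    (forall z, sec L (e |: ~: (e |: A)) z -> om (z e) a = 0).
  by apply: half; rewrite // setU1_compl // setCK.
by move: l2 o2; rewrite setU1_compl // lamC.
Qed.

Lemma minor_split_lc G v e a A : minor_split (graph_sys (local_compl G v)) e a A ->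
  minor_split (graph_sys G) e (lc_pauli G v e a) A.
Proof.
have half X : (dm (dirsec (graph_sys (local_compl G v)) e a X) <=
    dm (dirsec (graph_sys G) e (lc_pauli G v e a) X))%N.
  apply: (@dm_inj _ _ (lc_vec G v)).
  - exact: sec_om_subgroup (graph_sys_isotropic _) _ _ _.
  - exact: sec_om_subgroup (graph_sys_isotropic _) _ _ _.
  - by move=> x y; apply/ffunP => u; rewrite !ffunE lc_pauliD.
  - move=> x /ffunP H; apply/ffunP => u; have := H u; rewrite !ffunE => /eqP.
    by rewrite lc_pauli_eq0 => /eqP.
  move=> x /andP[/secP[Lx sx] ox]; rewrite /dirsec ffunE om_lc ox andbT.
  apply/secP; split=> [|u uX]; first exact: graph_sys_lcV.
  by rewrite ffunE sx //; apply/eqP; rewrite lc_pauli_eq0.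
case=> eA A2 B2 dA dB; split=> //; first by apply: leq_trans dA _; rewrite ltnS.
by apply: leq_trans dB _; rewrite ltnS.
Qed.

Lemma is_split_sym (S : finType) (G : sgraph S) (A B : {set S}) :
  is_split G A B -> is_split G B A.
Proof.
case/and4P => /eqP U D m /existsP[A' /existsP[B' /and3P[sA sB /forall_inP E]]].
rewrite /is_split setUC U eqxx disjoint_sym D minnC m /=.
apply/existsP; exists B'; apply/existsP; exists A'; rewrite sA sB /=.
apply/forall_inP => x xB; apply/forall_inP => y yA.
by rewrite adj_sym andbC; apply: (forall_inP (E y yA)).
Qed.

(** Ask that first components vanish off [A1] and that their sum over [A'] vanish (the coordinate
    [None]), which kills second components on [B]. These [#|~: A1| + 1] conditions leave at least
    [#|A1| - 1] dimensions. *)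
Lemma split_dirsec G v (A B : {set {x : T | x != v}}) : is_split (del G v) A B ->
  (#|val @: A| <= (dm (dirsec (graph_sys G) v pauliZ (val @: A))).+1)%N.
Proof.
case/and4P => /eqP U D _ /existsP[A' /existsP[B' /and3P[sA _ /forall_inP E]]].
set A1 := val @: A; have isoG := graph_sys_isotropic G.
pose f x : {ffun option {u | u \notin A1} -> ('F_2)^o} :=
  [ffun o => if o is Some u then (x (val u)).1 else \sum_(u in A') (x (val u)).1].
have := @dm_ker T _ f (graph_sys G) (dirsec (graph_sys G) v pauliZ A1)
  (iso_subgroup isoG) (sec_om_subgroup isoG _ _ _).
rewrite /dim /= muln1 card_option card_sig => H.
have {H} : (dm (graph_sys G) <= dm (dirsec (graph_sys G) v pauliZ A1) + #|~: A1|.+1)%N.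
  rewrite (_ : #|~: A1| = #|[pred u | u \notin A1]|); last first.
    by apply: eq_card => u; rewrite !inE.
  apply: H.
    move=> x y; apply/ffunP => -[u|]; rewrite !ffunE //.
    by rewrite -big_split; apply: eq_bigr => u _; rewrite ffunE.
  move=> x Lx /ffunP fx.
  have x1 u : u \notin A1 -> (x u).1 = 0.
    by move=> uA; have := fx (Some (exist _ u uA)); rewrite !ffunE.
  have vA : v \notin A1.
    by apply/imsetP => -[[u uv] _ /= E']; rewrite E' eqxx in uv.
  apply/andP; split; last by rewrite /om x1 // mul0r mulr0 subrr.
  apply/secP; split=> // w; rewrite !inE negb_or => /andP[wv wA].
  have wB : exist _ w wv \in B.
    have : exist _ w wv \in A :|: B by rewrite U inE.
    rewrite inE => /orP[] // wA'; case/negP: wA.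
    by apply/imsetP; exists (exist _ w wv).
  have xw2 : (x w).2 = 0.
    have /graph_sysP -> := Lx.
    rewrite /nbr_sum (bigID (mem A1)) /= [X in _ + X]big1 ?addr0; last first.
      by move=> u uA; rewrite x1 // mulr0.
    rewrite big_imset /=; last by move=> ? ? _ _; apply: val_inj.
    rewrite (eq_bigr (fun z : {x : T | x != v} => if z \in A' then (exist _ w wv \in B')%:R * (x (val z)).1 else 0)).
      rewrite -big_mkcondr /= (eq_bigl (mem A')).
        rewrite -mulr_sumr; have := fx None; rewrite !ffunE => ->; exact: mulr0.
      by move=> u /=; case uA : (u \in A'); rewrite ?andbF // andbT (subsetP sA).
    move=> u uA; have /forall_inP/(_ _ wB)/eqP := E u uA.
    by rewrite /= /del_adj /= => ->; case: (u \in A') => //=; rewrite mul0r.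
  by move: (x1 _ wA) xw2; case: (x w) => ? ? /= -> ->.
by have := iso_dim isoG; have := cardsC A1; clear; lia.
Qed.

Lemma split_minor_split G v : ~~ prime_graph (del G v) ->
  exists A, minor_split (graph_sys G) v pauliZ A.
Proof.
rewrite negbK => /existsP[A /existsP[B sAB]].
have hA := split_dirsec sAB; have hB := split_dirsec (is_split_sym sAB).
case/and4P: sAB => /eqP U D; rewrite leq_min => /andP[A2 B2] _.
have E : ~: (v |: val @: A) = val @: B.
  apply/setP => w; rewrite !inE negb_or; apply/idP/imsetP => [/andP[wv wA]|[[u uv] uB /= ->]].
    exists (exist _ w wv) => //; have : exist _ w wv \in A :|: B by rewrite U inE.
    rewrite inE => /orP[] // wA'; case/negP: wA.
    by apply/imsetP; exists (exist _ w wv).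
  rewrite uv; apply/imsetP => -[[u' uv'] uA /= E].
  have := disjointFr D uA; rewrite -(_ : exist _ u uv = exist _ u' uv') ?uB //.
  exact: val_inj.
exists (val @: A); split; rewrite ?E ?card_imset //; try exact: val_inj.
- by apply/imsetP => -[[u uv] _ /= E']; rewrite E' eqxx in uv.
- by move: hA; rewrite card_imset //; exact: val_inj.
- by move: hB; rewrite card_imset //; exact: val_inj.
Qed.

(** The minors [G \ v], [G * v \ v], [G / v] have directions [pauliZ], [pauliY], [pauliX]; two
    non-prime ones give splits in two distinct directions. *)
Lemma essential_ess G v : prime_graph G -> (5 <= #|T|)%N -> ~~ non_essential G v ->
  ess (graph_sys G) v.
Proof.
move=> Gp T5; have isoG := graph_sys_isotropic G; have primeG := prime_graph_sys Gp.
have ds a A := @minor_split_dsplit (graph_sys G) v a A isoG primeG.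
have dirs a b : a != 0 -> b != 0 -> a != b ->
    (exists A, minor_split (graph_sys G) v a A) ->
    (exists A, minor_split (graph_sys G) v b A) -> ess (graph_sys G) v.
  move=> a0 b0 ab [A sA] [B sB] c; case: (eqVneq c a) => [->|ca].
    by exists b, B; split=> //; apply: ds.
  by exists a, A; split=> //; apply: ds.
have Z : ~~ prime_graph (del G v) -> exists A, minor_split (graph_sys G) v pauliZ A.
  exact: split_minor_split.
have Y : ~~ prime_graph (del (local_compl G v) v) ->
    exists A, minor_split (graph_sys G) v pauliY A.
  case/split_minor_split => A /minor_split_lc.
  have -> : lc_pauli G v v pauliZ = pauliY by rewrite /lc_pauli eqxx; apply/eqP.
  by exists A.
have X : ~~ prime_graph (contract G v) ->
    exists A, minor_split (graph_sys G) v pauliX A.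
  rewrite /contract; case: pickP => [w Gvw|noE _]; last first.
    (* An isolated [v] would carry a vector supported at [v] alone, which [sec_pair0] excludes. *)
    have : sec (graph_sys G) [set v; v] [ffun u => if u == v then pauliX else 0].
      apply/secP; split=> [|u]; last by rewrite !inE orbb ffunE => /negPf ->.
      apply/graph_sysP => u; rewrite ffunE /nbr_sum big1.
        by case: eqP.
      move=> w _; rewrite ffunE; case: eqP => [->|_]; last by rewrite mulr0.
      by have := noE u; rewrite /= => ->; rewrite mul0r.
    by move=> /(sec_pair0 isoG primeG T5)/ffunP/(_ v); rewrite !ffunE eqxx => /eqP.
  case/split_minor_split => A; rewrite /pivot => /minor_split_lc/minor_split_lc/minor_split_lc.
  have wv : v != w by apply: contraTneq Gvw => ->; rewrite adj_irr.
  have -> : lc_pauli (local_compl (local_compl G v) w) v v pauliZ = pauliY.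
    by rewrite /lc_pauli eqxx; apply/eqP.
  have -> : lc_pauli (local_compl G v) w v pauliY = pauliX.
    by rewrite /lc_pauli (negPf wv) adj_sym local_compl_nbr Gvw; apply/eqP.
  have -> : lc_pauli G v v pauliX = pauliX.
    by rewrite /lc_pauli eqxx; apply/eqP.
  by exists A.
rewrite /non_essential.
case: (prime_graph (del G v)) Z => Z;
  case: (prime_graph (del (local_compl G v) v)) Y => Y;
  case: (prime_graph (contract G v)) X => X // _.
- exact: dirs (Y isT) (X isT).
- exact: dirs (Z isT) (X isT).
- exact: dirs (Z isT) (Y isT).
- exact: dirs (Z isT) (Y isT).
Qed.

End Minors.

(** * Change of frame by local complementations *)

Section Frames.
Local Open Scope ring_scope.
Variable T : finType.
Implicit Types (G H : sgraph T) (x y : pvec T) (u v w : T) (A : T -> pauli).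

(* [A] picks a nonzero value at every vertex; it is the Z-frame of some graph locally
   equivalent to [G] exactly when no nonzero vector takes only values [0] and [A v]. *)
Definition eulerian G A :=
  forall x, graph_sys G x -> (forall v, om (x v) (A v) = 0) -> x = 0.

Definition reframes G A := exists (s : seq T) (psi : T -> pauli -> pauli),
  [/\ forall v, psi v (A v) = pauliZ, forall v, psi v 0 = 0, forall v, injective (psi v)
    & forall x, graph_sys G x ->
        graph_sys (foldl (@local_compl T) G s) [ffun v => psi v (x v)]].

Lemma eulerian_lc G A v : eulerian G A ->
  eulerian (local_compl G v) (fun u => lc_pauli G v u (A u)).
Proof.
move=> eul x /graph_sys_lcV Lx ox.
have /ffunP x0 : lc_vec G v x = 0.
  by apply: eul Lx _ => u; rewrite ffunE -(om_lc G v u) lc_pauliK.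
apply/ffunP => u; have := x0 u; rewrite !ffunE => /eqP.
by rewrite lc_pauli_eq0 => /eqP.
Qed.

Lemma reframes_lc G A v :
  reframes (local_compl G v) (fun u => lc_pauli G v u (A u)) -> reframes G A.
Proof.
case=> s [psi [psiA psi0 psiI psiG]]; exists (v :: s), (fun u a => psi u (lc_pauli G v u a)).
split=> // [u|u a b /psiI/(inv_inj (lc_pauliK G v u)) //|x /(graph_sys_lc v)/psiG].
  by rewrite (_ : lc_pauli G v u 0 = 0) //; apply/eqP; rewrite lc_pauli_eq0.
by congr (graph_sys _ _); apply/ffunP => u; rewrite !ffunE.
Qed.

(** Each move leaves fewer vertices where [A] is not [pauliZ]: complement at a vertex with [pauliY];
    for adjacent [v], [w] with [pauliX], complement at [w], which makes [v] a [pauliY], then at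
    [v]. *)
Lemma eulerian_reframes G A : (forall v, A v != 0) -> eulerian G A -> reframes G A.
Proof.
have [n] := ubnP #|[set v | A v != pauliZ]|.
elim: n G A => // n IHn G A; rewrite ltnS => leDn A0 eul.
pose lcA v u := lc_pauli G v u (A u).
have lcA0 v u : lcA v u != 0 by rewrite lc_pauli_eq0.
have lcZ v u : A v != pauliZ -> A u = pauliZ -> lcA v u = pauliZ.
  move=> Av Au; rewrite /lcA /lc_pauli Au; case: eqP => [uv|_].
    by rewrite -uv Au eqxx in Av.
  by case: (G v u) => //; apply/eqP.
case: (boolP [exists v, A v == pauliY]) => [/existsP[v /eqP Av]|noY].
  apply: (reframes_lc (v := v)); apply: IHn; [|by move=> u; apply: lcA0|exact: eulerian_lc].
  apply: leq_trans leDn; apply: proper_card; apply/properP; split.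
    apply/subsetP => u; rewrite !inE; apply: contra_neq; apply: lcZ.
    by rewrite Av.
  by exists v; rewrite !inE Av // /lc_pauli eqxx.
have AX v : A v != pauliZ -> A v = pauliX.
  move: noY; rewrite negb_exists => /forallP/(_ v); move: (A0 v).
  by elim/pauli_cases: (A v) => //= _ _ _; apply/eqP.
case: (boolP [exists v, exists w, [&& A v != pauliZ, A w != pauliZ & G v w]]).
  case/existsP => v /existsP[w /and3P[Av Aw Gvw]].
  have vw : v != w by apply: contraTneq Gvw => ->; rewrite adj_irr.
  have lcv : lcA w v = pauliY.
    by rewrite /lcA /lc_pauli (negPf vw) adj_sym Gvw AX //; apply/eqP.
  apply: (reframes_lc (v := w)); apply: (reframes_lc (v := v)); apply: IHn => //.
  - apply: leq_trans leDn; apply: proper_card; apply/properP; split.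
      apply/subsetP => u; rewrite !inE; apply: contra_neq => Au.
      rewrite -/(lcA w u) lcZ // /lc_pauli; case: eqP => [uv|_].
        by rewrite -uv Au eqxx in Av.
      by case: ifP => // _; apply/eqP.
    by exists v; rewrite !inE // -/(lcA w v) lcv /lc_pauli eqxx; apply/negPn.
  - by move=> u; rewrite !lc_pauli_eq0.
  exact/eulerian_lc/eulerian_lc.
rewrite negb_exists => /forallP noE.
exists [::], (fun _ => id); split=> [v|//|v a b //|x Lx]; last first.
  by rewrite (_ : [ffun v => x v] = x) //; apply/ffunP => v; rewrite ffunE.
apply/eqP; apply: contraT => Av.
(* The generator of [v] has [pauliX] at [v] and [pauliZ] at its neighbours, where [A] is now
   [pauliZ]; it commutes with [A] everywhere, against [eul]. *)
pose x : pvec T := [ffun u => ((u == v)%:R, (G v u)%:R)].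
have := eul x; have -> : graph_sys G x.
  apply/graph_sysP => u; rewrite ffunE /nbr_sum (bigD1 v) //= ffunE eqxx mulr1 big1 ?addr0 //.
  by move=> w wv; rewrite ffunE (negPf wv) mulr0.
move=> /(_ isT) H; have {H} /ffunP/(_ v) : x = 0.
  apply: H => u; rewrite ffunE; case: (eqVneq u v) => [->|uv].
    by rewrite AX // adj_irr; apply/eqP.
  case Gvu: (G v u); last by rewrite om0l.
  have := noE v; rewrite negb_exists => /forallP/(_ u).
  by rewrite Av Gvu andbT /= negbK => /eqP ->; apply/eqP.
by rewrite !ffunE eqxx => /eqP.
Qed.

End Frames.

(** * From a ring of triplets to a cycle graph *)

Section RingCycle.
Local Open Scope ring_scope.
Variables (T : finType) (G : sgraph T).
Let L := graph_sys G.
Hypothesis primeL : prime_sys L.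
Hypothesis T5 : (5 <= #|T|)%N.
Let isoL : isotropic L := graph_sys_isotropic G.

Lemma om_eq0_plane (a b c : pauli) : om b c != 0 -> om a b = 0 -> om a c = 0 -> a = 0.
Proof.
by elim/pauli_cases: a; elim/pauli_cases: b => //; elim/pauli_cases: c => // /eqP + /eqP + /eqP.
Qed.

Variables (x0 : T) (p : seq T).
Hypothesis Up : uniq p.
Let k := size p.
Hypothesis k5 : (5 <= k)%N.
Let Q i := nth x0 p i.
Let nx i := if i.+1 == k then 0%N else i.+1.
Hypothesis triQ : forall i, (0 < i < k)%N -> tri L (Q i.-1) (Q i) (Q (nx i)).

(** In a frame [A] that agrees with each ring vector off its centre, a vector of [L] commuting with
    [A] vanishes on the ring except perhaps at [Q 0]. So the ring covers all vertices and [A] is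
    eulerian; once [A] is turned into [pauliZ], [t i] gives the neighbourhood of [Q i]. *)
Lemma ring_cycle : exists H, is_cycle_graph H /\ locally_equivalent G H.
Proof.
have QE i j : (i < k)%N -> (j < k)%N -> (Q i == Q j) = (i == j).
  by move=> ik jk; rewrite /Q nth_uniq.
have nxP i : (nx i == i.+1) && (i.+1 != k) || (nx i == 0%N) && (i.+1 == k).
  by rewrite /nx; case: (i.+1 == k); rewrite !eqxx.
have nxk i : (i < k)%N -> (nx i < k)%N by move: (nxP i) k5; clear; lia.
have [f fP] : exists f : T -> pvec T, forall v,
    (0 < index v p < k)%N ->
    tvec L (f v) (Q (index v p).-1) (Q (index v p)) (Q (nx (index v p))).
  apply: (@fin_all_exists _ _ (fun v t => (0 < index v p < k)%N ->
    tvec L t (Q (index v p).-1) (Q (index v p)) (Q (nx (index v p))))) => v.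
  case: (boolP (0 < index v p < k)%N) => [/triQ/(triP isoL primeL T5)[t tt]|_]; last by exists 0.
  by exists t.
pose t i := f (Q i).
have tP i : (0 < i < k)%N -> tvec L (t i) (Q i.-1) (Q i) (Q (nx i)).
  by move=> ik; have := fP (Q i); rewrite /Q index_uniq //; [apply|case/andP: ik].
have Lt i : (0 < i < k)%N -> L (t i) by case/tP.
have tQ i a : (0 < i < k)%N -> (a < k)%N ->
    (t i (Q a) != 0) = [|| a == i.-1, a == i | a == nx i].
  move=> ik ak; have [_ _ ->] := tP i ik; case/andP: ik => i0 ik.
  by rewrite !inE !QE ?nxk //; apply: leq_ltn_trans (leq_pred _) ik.
have same i j a : (0 < i < k)%N -> (0 < j < k)%N -> (a < k)%N ->
    [|| a == i.-1, a == i | a == nx i] -> [|| a == j.-1, a == j | a == nx j] ->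
    (forall b, b < k -> [|| b == i.-1, b == i | b == nx i] ->
      [|| b == j.-1, b == j | b == nx j] -> b = a)%N ->
    t i (Q a) = t j (Q a).
  move=> ik jk ak ai aj H; apply/eqP; rewrite -om_eq0 ?tQ //; apply/eqP/(om_share1 isoL) => [||w wa];
    try exact: Lt.
  case: (eqVneq (t i w) 0) => tw; [by left | right; apply/eqP].
  have [b bk wb] : exists2 b, (b < k)%N & w = Q b.
    move: tw; have [_ _ ->] := tP i ik; case/andP: ik => i0 ik.
    rewrite !inE => /or3P[] /eqP ->; [exists i.-1|exists i|exists (nx i)]; rewrite ?nxk //.
    exact: leq_ltn_trans (leq_pred _) ik.
  apply: contraNT wa; rewrite wb in tw *; move: tw; rewrite !tQ // => bi bj.
  by rewrite (H b).
(* [A v] is the common value at [v] of the vectors centred at the two neighbours of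
   [v] on the ring; the vector centred at [Q 0] is not available. *)
pose A v := if index v p is i.+2 then t i.+1 v
  else if index v p == 1%N then t 2%N v else t 1%N v.
have AQ a : (a < k)%N -> A (Q a) = if a is i.+2 then t i.+1 (Q a)
    else if a == 1%N then t 2%N (Q a) else t 1%N (Q a).
  by move=> ak; rewrite /A /Q index_uniq.
have A_prev i : (0 < i < k)%N -> t i (Q i.-1) = A (Q i.-1).
  move=> ik; rewrite AQ; last by move: ik; clear; lia.
  case: i ik => [|[|[|i]]] //= ik.
  have n1 := nxP i.+3; have n2 := nxP i.+1.
  by apply: (same i.+3 i.+1 i.+2); try (move=> b); move: ik k5 n1 n2; clear; lia.
have A_next i : (0 < i < k)%N -> t i (Q (nx i)) = A (Q (nx i)).
  move=> ik; rewrite AQ; last by apply: nxk; case/andP: ik.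
  have := nxP i; case/orP=> /andP[/eqP-> ki]; first by case: i ik ki.
  have n1 := nxP i; have n2 := nxP 1%N.
  by apply: (same i 1%N 0%N); try (move=> b); move: ik k5 ki n1 n2; clear; lia.
(* [A (Q i)] is the value of an adjacent ring vector, which shares two vertices with [t i]. *)
have A_mid i : (0 < i < k)%N -> om (t i (Q i)) (A (Q i)) != 0.
  move=> ik; rewrite AQ; last by case/andP: ik.
  case: i ik => [|[|i]] //= ik.
    have nx1 : nx 1%N = 2%N by have := nxP 1%N; move: k5; clear; lia.
    have t1 := tP 1%N ik; have k2 : (0 < 2 < k)%N by move: k5; clear; lia.
    have t2 := tP 2%N k2; rewrite /= nx1 in t1 t2.
    have t1' := tvec_perm (perm_trans (perm12 _ _ _) (perm23 _ _ _)) t1.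
    apply: (om_share2 isoL primeL T5 t1' t2); rewrite QE ?nxk //.
      by have n2 := nxP 2%N; move: n2 k5; clear; lia.
    by move: k5; clear; lia.
  have ik' : (0 < i.+1 < k)%N by move: ik; clear; lia.
  have ti := tP i.+2 ik; have tj := tP i.+1 ik'; rewrite /= in ti tj.
  have ti' := tvec_perm (perm12 _ _ _) ti.
  have tj' := tvec_perm (perm13 _ _ _) tj.
  have nxi : nx i.+1 = i.+2 :> nat by have := nxP i.+1; move: ik; clear; lia.
  rewrite nxi in tj'; apply: (om_share2 isoL primeL T5 ti' tj').
  have n2 := nxP i.+2; rewrite QE ?nxk //; move: ik k5 n2; clear; lia.
have A0 a : (a < k)%N -> A (Q a) != 0.
  move=> ak; rewrite AQ //; have n1 := nxP 1%N; have n2 := nxP a.-1.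
  by case: a ak n2 => [|[|a]] /= ak n2; rewrite tQ //; move: ak k5 n1 n2; clear; lia.
have vanish x : L x -> (forall a, (a < k)%N -> om (x (Q a)) (A (Q a)) = 0) ->
    forall i, (0 < i < k)%N -> x (Q i) = 0.
  move=> Lx ox i ik; have ik' : (i < k)%N by case/andP: ik.
  have pk : (i.-1 < k)%N by apply: leq_ltn_trans (leq_pred _) ik'.
  apply: (om_eq0_plane (A_mid i ik)); last exact: ox.
  have := iso_form isoL Lx (Lt i ik); rewrite /form (bigD1 (Q i)) //= big1 ?addr0 // => w wi.
  case: (eqVneq (t i w) 0) => [->|]; first exact: om0r.
  have [_ _ ->] := tP i ik; rewrite !inE (negPf wi) /= => /orP[] /eqP ->.
    by rewrite A_prev // ox.
  by rewrite A_next // ox // nxk.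
have inp v : v \in p.
  (* The [k] conditions in [P] leave dimension [#|T| - k] at least, but by [vanish]
     its vectors live on [Q 0] and the vertices outside the ring. *)
  pose P : pred (pvec T) := fun x => L x && [forall a : 'I_k, om (x (Q a)) (A (Q a)) == 0].
  have sP : subgroupP P.
    have [L0 LD] := iso_subgroup isoL; split.
      by rewrite /P L0; apply/forallP => a; rewrite ffunE om0l.
    move=> x y /andP[Lx /forallP ox] /andP[Ly /forallP oy]; rewrite /P LD //=.
    by apply/forallP => a; rewrite ffunE omDl (eqP (ox a)) (eqP (oy a)) addr0.
  pose g x : {ffun 'I_k -> ('F_2)^o} := [ffun a : 'I_k => om (x (Q a)) (A (Q a))].
  have dP : (#|T| <= dm P + k)%N.
    apply: leq_trans (iso_dim isoL) _.
    have := @dm_ker T _ g L P (iso_subgroup isoL) sP; rewrite /dim /= card_ord muln1; apply.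
      by move=> x y; apply/ffunP => a; rewrite !ffunE omDl.
    move=> x Lx /ffunP gx; rewrite /P Lx; apply/forallP => a.
    by have := gx a; rewrite !ffunE => ->.
  pose X := Q 0%N |: ~: [set u in p].
  have dX : (dm P <= dsec L X)%N.
    apply: dm_mono => //; first exact: sec_subgroup.
    move=> x /andP[Lx /forallP ox]; apply/secP; split=> // u.
    rewrite !inE negb_or negbK => /andP[u0 up].
    have uk : (index u p < k)%N by rewrite /k index_mem.
    rewrite -(nth_index x0 up); apply: vanish => // [a ak|].
      exact/eqP/(ox (Ordinal ak)).
    rewrite uk andbT lt0n; apply: contra u0 => /eqP iu.
    by rewrite -(nth_index x0 up) iu.
  have Q0p : Q 0%N \in p by apply: mem_nth; apply: leq_trans k5.
  have cp : #|[set u in p]| = k by rewrite cardsE; apply/card_uniqP.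
  have cX : #|X| = (#|~: [set u in p]|).+1 by rewrite cardsU1 !inE negbK Q0p.
  have cX' : (k <= #|~: X|.+1)%N.
    have := cardsC X; have := cardsC [set u in p]; rewrite cX cp; clear; lia.
  have := primeL (X := X); have := cardsC [set u in p]; rewrite cp cX => cC pX.
  (* If the ring missed [v], [X] would have at least two vertices and dimension at least [#|X| - 1],
     against primality. *)
  apply: contraT => vp; have : (0 < #|~: [set u in p]|)%N.
    by rewrite card_gt0; apply/set0Pn; exists v; rewrite !inE.
  by move: pX cX' dX dP cC k5; clear; lia.
have cT : #|T| = k.
  by rewrite /k -(card_uniqP Up); apply: eq_card => v; rewrite inp.
have Qi v : v = Q (index v p) by rewrite /Q nth_index.
have ik v : (index v p < k)%N by rewrite /k index_mem.
have eul : eulerian G A.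
  move=> x Lx ox; apply: (@sec_pair0 _ _ isoL primeL T5 (Q 0%N) (Q 0%N)).
  apply/secP; split=> // v; rewrite !inE orbb => v0.
  rewrite (Qi v); apply: vanish => // ; rewrite ik andbT lt0n.
  by apply: contra v0 => /eqP E; rewrite {1}(Qi v) E.
have [s [psi [psiA psi0 psiI psiG]]] : reframes G A.
  by apply: eulerian_reframes eul => v; rewrite (Qi v) A0.
set H := foldl (@local_compl T) G s in psiG.
exists H; split; last by exists s.
have adjQ i b : (0 < i < k)%N -> (b < k)%N -> H (Q i) (Q b) = (b == i.-1) || (b == nx i).
  move=> ik' bk; have ii : (i < k)%N by case/andP: ik'.
  case: (eqVneq b i) => [->|bi].
    rewrite adj_irr; apply/esym/negbTE; rewrite negb_or.
    by have := nxP i; move: ik' k5; clear; lia.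
  pose y : pvec T := [ffun v => psi v (t i v)].
  have /graph_sysP/(_ (Q b)) : graph_sys H y := psiG _ (Lt i ik').
  (* Off the centre, nonzero values equal [A] and become [pauliZ], with first component 0; the value
     at the centre becomes neither 0 nor [pauliZ], so its first component is 1. *)
  have y1 u : (y u).1 = (u == Q i)%:R.
    rewrite ffunE (Qi u) QE //; case: (eqVneq (index u p) i) => [->|ui].
      have : psi (Q i) (t i (Q i)) != 0.
        by rewrite -[X in _ != X](psi0 (Q i)) (inj_eq (psiI _)) tQ // eqxx orbT.
      have : psi (Q i) (t i (Q i)) != pauliZ.
        rewrite -[X in _ != X](psiA (Q i)) (inj_eq (psiI _)).
        by apply: contraNneq (A_mid i ik') => ->; rewrite omaa.
      by elim/pauli_cases: (psi _ _).
    case tz : (t i (Q (index u p)) == 0); first by rewrite (eqP tz) psi0.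
    move/negbT: tz; rewrite tQ // (negPf ui) /= => /orP[] /eqP ->.
      by rewrite A_prev // psiA.
    by rewrite A_next // psiA.
  have -> : nbr_sum H y (Q b) = (H (Q i) (Q b))%:R.
    rewrite /nbr_sum (bigD1 (Q i)) //= y1 eqxx mulr1 big1 ?addr0 // => u ui.
    by rewrite y1 (negPf ui) mulr0.
  rewrite ffunE; have tb := tQ i b ik' bk; rewrite (negPf bi) /= in tb.
  case E : ((b == i.-1) || (b == nx i)).
    have -> : t i (Q b) = A (Q b) by case/orP: E => /eqP ->; rewrite ?A_prev ?A_next.
    by rewrite psiA; case: (H _ _).
  rewrite E in tb; move/negbFE/eqP: tb => ->; rewrite psi0.
  by case: (H _ _).
exists k; split; first by apply: leq_trans k5.
exists (fun i : 'I_k => Q i); split.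
  apply: inj_card_bij; last by rewrite card_ord cT.
  by move=> i j /eqP; rewrite QE // => /eqP/val_inj.
have ordSE (i : 'I_k) : ordS i = nx i :> nat.
  rewrite /= /nx; case: eqP => [->|ni]; first by rewrite modnn.
  by rewrite modn_small // ltn_neqAle (ltn_ord i) andbT; apply/eqP.
have eqS (i j : 'I_k) : (j == ordS i) = (j == nx i :> nat) by rewrite -ordSE.
have formula (i j : 'I_k) : (0 < i)%N -> H (Q i) (Q j) = (j == ordS i) || (i == ordS j).
  move=> i0; rewrite adjQ ?i0 //= orbC !eqS; congr (_ || _).
  by have := ltn_ord i; have := nxP j; move: i0 k5; clear; lia.
(* The row of [Q 0] follows by symmetry, its diagonal entry by irreflexivity. *)
move=> i j; case: (posnP i) => [i0|]; last exact: formula.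
case: (posnP j) => [j0|j0]; last by rewrite adj_sym formula // orbC.
rewrite !eqS i0 j0 adj_irr.
by have := nxP 0%N; move: k5; clear; lia.
Qed.

End RingCycle.

Theorem theorem1p1 (T : finType) (G : sgraph T)
    (G_prime : prime_graph G) (G_card : 5 <= #|T|)
    (G_not_cycle :
      ~ (exists H : sgraph T, is_cycle_graph H /\ locally_equivalent G H)) :
  2 <= #|[set v : T | non_essential G v]|.
Proof.
have isoG := graph_sys_isotropic G; have primeG := prime_graph_sys G_prime.
have := ring_or_two isoG primeG G_card (fun v => @essential_ess T G v G_prime G_card).
case=> [[p [[U tri3] p5 tri_last]]|[x [y [xy nx ny]]]]; last first.
  by apply/card_gt1P; exists x, y; rewrite !inE.
have x0 : T by case: p p5 {U tri3 tri_last}.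
(* Reversal moves the vertex at which no triplet is centred from the last place to position 0. *)
case: G_not_cycle; apply: (@ring_cycle T G primeG G_card x0 (rev p)); rewrite ?rev_uniq ?size_rev //.
move=> i /andP[i0 ip].
have pk : i.-1 < size p by apply: leq_ltn_trans (leq_pred _) ip.
rewrite (nth_rev x0 pk) (nth_rev x0 ip) prednK //; case: eqP => [ip1|ni].
  have p1 : 0 < size p by apply: leq_trans p5.
  rewrite nth_rev // subn1; have := tri_last x0.
  have -> : size p - i = 1 by move: ip1; clear; lia.
  have -> : size p - i.+1 = 0 by move: ip1; clear; lia.
  by apply: tri_perm; exact: perm12.
have ip' : i.+1 < size p by move: ip ni; clear; lia.
rewrite nth_rev //.
have -> : size p - i = (size p - i.+2).+2 by move: ip'; clear; lia.
have -> : size p - i.+1 = (size p - i.+2).+1 by move: ip'; clear; lia.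
apply: tri_perm (perm13 _ _ _) (tri3 _ _ _).
by move: i0 ip'; clear; lia.
Qed.
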